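(* Let $n\ge 4$ and let $T$ be a triangulation of a regular $n$-gon whose edges are labeled $1,\dots,n$ in cyclic order. Then the cross-ratio degree $d_T$ equals $2^{I(T)}$, where $I(T)$ is the number of triangles of $T$ none of whose three sides is an edge of the $n$-gon.
   Context: For a finite set $A$ with $|A|\ge 3$, $M_{0,A}$ denotes the moduli space of configurations of $|A|$ distinct points on $\mathbb{P}^1_{\mathbb{C}}$ labeled by $A$, modulo Möbius transformations; it is a smooth affine variety of dimension $|A|-3$, and for $S\subseteq A$ with $|S|\ge 3$ there is a forgetful map $M_{0,A}\to M_{0,S}$ remembering only the points labeled by $S$. For $|S|=4$, $M_{0,S}\cong\mathbb{P}^1\setminus\{0,1,\infty\}$ via the cross-ratio. For a collection $\mathcal{V}=(S_1,\dots,S_k)$ of 4-element subsets of $A$, the cross-ratio degree $d_{A,\mathcal{V}}$ is defined as follows: if $k=|A|-3$, it is the degree of the product of forgetful maps $\pi_{\mathcal{V}}:M_{0,A}\to\prod_{j=1}^k M_{0,S_j}$ (the cardinality of a general fiber, taken to be $0$ if the map is not dominant; when $|A|=3$ and $\mathcal{V}$ is empty this is $1$); if $k\neq |A|-3$, set $d_{A,\mathcal{V}}=0$. Triangulations: label the edges of a regular $n$-gon by $[n]=\{1,\dots,n\}$ in cyclic order. A diagonal $D$ touches exactly four edges (the two edges at each endpoint of $D$); let $S_D\subseteq[n]$ be this 4-element set. A triangulation $T$ is a choice of $n-3$ pairwise non-crossing diagonals; let $\mathcal{U}_T=\{S_D: D\in T\}$, and $d_T:=d_{[n],\mathcal{U}_T}$,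 i.e. the degree of $\pi_T:M_{0,[n]}\to\prod_{D\in T}M_{0,S_D}$. *)

(* Defs.v *)
From Stdlib Require Import ClassicalEpsilon.
From mathcomp Require Import all_boot all_order all_algebra.
From mathcomp Require Import complex.
From mathcomp Require Import Rstruct.
From mathcomp Require Import mpoly.

Set Implicit Arguments.
Unset Strict Implicit.
Unset Printing Implicit Defensive.
Import Order.TTheory GRing.Theory Num.Theory.
Local Open Scope ring_scope.

Definition CC : fieldType := complex Rdefinitions.R.

(* Points of P^1(C): [None] is the point at infinity. *)
Definition P1 := option CC.

(* Difference of two points of P^1, where a factor involving infinity is
   replaced by 1 (these factors cancel in the cross-ratio). *)
Definition pdiff (a b : P1) : CC :=
  match a, b with Some x, Some y => x - y | _, _ => 1 end.

(* Cross-ratio (a,b;c,d) = (a-c)(b-d) / ((a-d)(b-c)), extended to P^1;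
   for four distinct points it lies in P^1 \ {0,1,oo}.  This is the chosen
   identification M_{0,4} ~= P^1 \ {0,1,oo}. *)
Definition crossratio (a b c d : P1) : CC :=
  (pdiff a c * pdiff b d) / (pdiff a d * pdiff b c).

Definition crS (n : nat) (p : 'I_n -> P1) (S : {set 'I_n}) : CC :=
  match enum S with
  | [:: a; b; c; d] => crossratio (p a) (p b) (p c) (p d)
  | _ => 0
  end.

(* Normal form of M_{0,[n]}: every configuration of n distinct labelled
   points of P^1 is equivalent under a unique Moebius transformation to one
   with p_0 = oo, p_1 = 0, p_2 = 1; the remaining points are given by
   x : 'rV_(n-3). *)
Definition conf (n : nat) (x : 'rV[CC]_(n - 3)) (i : 'I_n) : P1 :=
  match nat_of_ord i with
  | 0 => None
  | 1 => Some 0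
  | 2 => Some 1
  | k.+3 => Some (if @insub _ (fun j => j < n - 3)%N _ k is Some j
                  then x ord0 j else 0)
  end.

Definition in_M0n (n : nat) (x : 'rV[CC]_(n - 3)) : Prop :=
  injective (conf x).

(* The product of forgetful maps pi_V : M_{0,[n]} -> prod_j M_{0,S_j}. *)
Definition piV (n : nat) (V : seq {set 'I_n}) (x : 'rV[CC]_(n - 3))
  : 'rV[CC]_(size V) :=
  \row_(j < size V) crS (conf x) (nth set0 V j).

(* y is a point of prod_j M_{0,S_j} = (P^1 \ {0,1,oo})^k. *)
Definition in_target (k : nat) (y : 'rV[CC]_k) : Prop :=
  forall j, y ord0 j != 0 /\ y ord0 j != 1.

Definition fiber_card (n : nat) (V : seq {set 'I_n}) (y : 'rV[CC]_(size V))
  (d : nat) : Prop :=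
  exists s : seq 'rV[CC]_(n - 3),
    [/\ uniq s, size s = d &
        forall x, x \in s <-> (in_M0n x /\ piV V x = y)].

(* d is the cardinality of a general fiber of pi_V: there is a nonempty
   Zariski open subset of the target (complement of the zero set of a
   nonzero polynomial) over which all fibers have exactly d points.
   (If pi_V is not dominant, general fibers are empty, so d = 0.) *)
Definition is_general_fiber_card (n : nat) (V : seq {set 'I_n}) (d : nat)
  : Prop :=
  exists g : mpoly.mpoly (size V) CC,
    g != 0 /\
    forall y : 'rV[CC]_(size V), in_target y ->
      mpoly.meval (fun j => y ord0 j) g != 0 -> @fiber_card n V y d.

Definition crdeg (n : nat) (V : seq {set 'I_n}) : nat :=
  if size V == (n - 3)%N then
    epsilon (inhabits 0%N) (is_general_fiber_card V)
  else 0%N.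

(* Vertices of the n-gon are 'I_n; edge i joins vertex i and vertex i+1
   (mod n), so edges are labelled 0,...,n-1 in cyclic order. *)

Definition adjacent (n : nat) (u v : 'I_n) : bool :=
  (v == ordS u) || (u == ordS v).

Definition diagonal (n : nat) (D : {set 'I_n}) : bool :=
  (#|D| == 2) && [forall u in D, forall v in D, (u != v) ==> ~~ adjacent u v].

Definition crossing (n : nat) (D E : {set 'I_n}) : bool :=
  [exists a in D, exists b in D, exists c in E, exists d in E,
     ((a < c) && (c < b) && (b < d))%N].

Definition triangulation (n : nat) (T : {set {set 'I_n}}) : Prop :=
  [/\ forall D, D \in T -> diagonal D,
      #|T| = (n - 3)%N &
      forall D E, D \in T -> E \in T -> ~~ crossing D E].

(* S_D: the four edges touched by D (the two edges at each endpoint). *)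
Definition S_of (n : nat) (D : {set 'I_n}) : {set 'I_n} :=
  \bigcup_(u in D) [set ord_pred u; u].

(* The collection U_T, listed in some order (the degree does not depend on it). *)
Definition U_T (n : nat) (T : {set {set 'I_n}}) : seq {set 'I_n} :=
  [seq S_of D | D <- enum T].

Definition d_T (n : nat) (T : {set {set 'I_n}}) : nat := crdeg (U_T T).

(* Triangles of T: 3-sets of vertices each pair of which is a side of the
   polygon or a diagonal of T.  Interior triangles: no side is a polygon
   edge, i.e. all three pairs are diagonals of T. *)
Definition interior_triangles (n : nat) (T : {set {set 'I_n}}) : nat :=
  #|[set X : {set 'I_n} | (#|X| == 3) &&
       [forall u in X, forall v in X, (u != v) ==> ([set u; v] \in T)]]|.

(* Main.v *)
From Stdlib Require Import ClassicalEpsilon.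
Require Import Defs.
From mathcomp Require Import all_boot all_order all_algebra.
From mathcomp Require Import complex Rstruct mpoly.
From mathcomp Require Import ring zify.

(** Points of the projective line are represented by vectors of F^2, and
    cross-ratios by brackets [a b] (2x2 determinants). Cut the polygon along
    the tree dual to the triangulation. If D is a diagonal with end edges a, b
    and c, d, and the triangle below D has its apex between the edges s and t,
    then, when the other two sides of this triangle are diagonals too, one can
    write s = [bd] a + nu [ad] b and t = y1 [bd] a + nu [ad] b, and the three
    equations attached to the sides of the triangle reduce to the quadratic
    equation (nu + y) (nu + y1) = y2 (nu + 1) (nu + y y1), which involves only
    the prescribed cross-ratios y, y1, y2 of these sides. When another side is
    an edge of the polygon, s and t are determined uniquely. So, for
    given y, the solutions up to Moebius transformations are parametrized by
    the choice of one root nu in each interior triangle, which gives 2 ^ I(T)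
    configurations as soon as the discriminants do not vanish and the points so
    constructed are pairwise distinct. The latter is an open condition on
    (y, nu); it is turned into an open condition on y by taking norms, which
    eliminates the nu one by one, starting from the root of the tree. The norm
    does not vanish identically because the cross-ratio y of the upper side is
    free once the triangles above it have been eliminated. *)

Set Implicit Arguments.
Unset Strict Implicit.
Unset Printing Implicit Defensive.
Import GRing.Theory Num.Theory.
Local Open Scope ring_scope.

(** * Polynomial functions *)

Section Fresh.
Variable F : fieldType.
Hypothesis char0 : forall m : nat, m.+1%:R != 0 :> F.

Lemma natr_inj0 : injective (fun m : nat => m%:R : F).
Proof.
move=> a b; wlog le_ab: a b / (a <= b)%N => [W|/=].
  by case/orP: (leq_total a b) => h e; [|symmetry]; apply: W.
rewrite -(subnKC le_ab) natrD => e.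
have : (b - a)%:R = 0 :> F by apply: (addrI (a%:R)); rewrite -e addr0.
case: (b - a)%N => [|m] e0; first by rewrite addn0.
by move: (char0 m); rewrite e0 eqxx.
Qed.

Lemma fresh_field (s : seq F) : exists z, z \notin s.
Proof.
pose c := [seq (i%:R : F) | i <- iota 0 (size s).+1].
case: (boolP (all (mem s) c)) => [/allP cs|]; last first.
  by case/allPn => z _ zs; exists z.
have : (size c <= size s)%N.
  by apply: uniq_leq_size => //; rewrite map_inj_uniq ?iota_uniq //; exact: natr_inj0.
by rewrite size_map size_iota ltnn.
Qed.

Lemma roots_list (g : {poly F}) : g != 0 -> exists s : seq F, forall x, root g x -> x \in s.
Proof.
elim: {g}(size g) {-2}g (leqnn (size g)) => [|m IH] g.
  by rewrite leqn0 size_poly_eq0 => ->.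
move=> sg g0; case: (classic (exists x, root g x)) => [[x rx]|nor]; last first.
  by exists [::] => x rx; case: nor; exists x.
have [q eg] := factor_theorem _ _ rx.
have q0 : q != 0 by apply: contraNneq g0 => q0; rewrite eg q0 mul0r.
have [|s Hs] := IH q _ q0.
  by move: sg; rewrite eg size_Mmonic ?monicXsubC // size_XsubC addn2 /= ltnS.
exists (x :: s) => z; rewrite eg rootM root_XsubC in_cons => /orP[/Hs->|->//].
by rewrite orbT.
Qed.

End Fresh.

Section PolyFun.
Variables (F : fieldType) (X : eqType).
Implicit Types (A B : X -> Prop) (f g h : (X -> F) -> F) (e : X -> F).

(** Polynomials are kept as functions on assignments, with [A] recording which variables may occur.
    Every constructor is closed under pointwise equality, so any formula of the right shape
    qualifies without functional extensionality. *)
Inductive polyfun A : ((X -> F) -> F) -> Prop :=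
| PfConst c f : (forall e, f e = c) -> polyfun A f
| PfVar x f : A x -> (forall e, f e = e x) -> polyfun A f
| PfAdd f g h : polyfun A f -> polyfun A g -> (forall e, h e = f e + g e) -> polyfun A h
| PfMul f g h : polyfun A f -> polyfun A g -> (forall e, h e = f e * g e) -> polyfun A h.

Lemma pf_const A c : polyfun A (fun=> c).
Proof. exact: (@PfConst _ c). Qed.

Lemma pf_var A x : A x -> polyfun A (fun e => e x).
Proof. by move=> Ax; apply: (@PfVar _ x). Qed.

Lemma pf_add A f g : polyfun A f -> polyfun A g -> polyfun A (fun e => f e + g e).
Proof. by move=> Hf Hg; apply: (PfAdd Hf Hg). Qed.

Lemma pf_mul A f g : polyfun A f -> polyfun A g -> polyfun A (fun e => f e * g e).
Proof. by move=> Hf Hg; apply: (PfMul Hf Hg). Qed.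

Lemma pf_opp A f : polyfun A f -> polyfun A (fun e => - f e).
Proof.
by move=> Hf; apply: (PfMul (pf_const A (-1)) Hf) => e; rewrite mulN1r.
Qed.

Lemma pf_sub A f g : polyfun A f -> polyfun A g -> polyfun A (fun e => f e - g e).
Proof. by move=> Hf Hg; apply: pf_add => //; apply: pf_opp. Qed.

Lemma pf_exp A f m : polyfun A f -> polyfun A (fun e => f e ^+ m).
Proof.
move=> Hf; elim: m => [|m IH]; first by apply: (@PfConst _ 1).
by apply: (PfMul Hf IH) => e; rewrite exprS.
Qed.

Lemma pf_prod A (I : Type) (r : seq I) (P : pred I) (f : I -> (X -> F) -> F) :
  (forall i, polyfun A (f i)) -> polyfun A (fun e => \prod_(i <- r | P i) f i e).
Proof.
move=> Hf; elim: r => [|i r IH]; first by apply: (@PfConst _ 1) => e; rewrite big_nil.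
case Pi: (P i); last by apply: (PfAdd (pf_const A 0) IH) => e; rewrite big_cons Pi add0r.
by apply: (PfMul (Hf i) IH) => e; rewrite big_cons Pi.
Qed.

Lemma pf_local A f e e' : polyfun A f -> (forall x, A x -> e x = e' x) -> f e = f e'.
Proof.
move=> Hf ee; elim: Hf => [c k E|x k Ax E|k g h _ IH1 _ IH2 E|k g h _ IH1 _ IH2 E].
- by rewrite !E.
- by rewrite !E ee.
- by rewrite !E IH1 IH2.
- by rewrite !E IH1 IH2.
Qed.

(** Substituting fractions with common denominator [D] and clearing it by a power of [D] stays
    inside [R]. The ring is left general in order to cover both univariate and multivariate
    polynomials. *)
Lemma pf_subst A f (R : comNzRingType) (cst : {rmorphism F -> R}) (N : X -> R) (D : R) :
  polyfun A f ->
  exists m (g : R), forall ev : {rmorphism R -> F}, (forall c, ev (cst c) = c) ->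
    ev D != 0 -> ev g = ev D ^+ m * f (fun x => ev (N x) / ev D).
Proof.
elim=> [c k E|x k Ax E|k g h _ [m1 [g1 H1]] _ [m2 [g2 H2]] E|k g h _ [m1 [g1 H1]] _ [m2 [g2 H2]] E].
- by exists 0, (cst c) => ev evc _; rewrite E evc mul1r.
- exists 1, (N x) => ev evc D0; rewrite E expr1; field; exact: D0.
- exists (m1 + m2)%N, (D ^+ m2 * g1 + D ^+ m1 * g2) => ev evc D0.
  by rewrite E rmorphD !rmorphM !rmorphXn H1 // H2 // exprD; ring.
- exists (m1 + m2)%N, (g1 * g2) => ev evc D0.
  by rewrite E rmorphM H1 // H2 // exprD; ring.
Qed.

Lemma pf_univariate A f (N : X -> {poly F}) (D : {poly F}) :
  polyfun A f ->
  exists m (g : {poly F}), forall z, D.[z] != 0 ->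
    g.[z] = D.[z] ^+ m * f (fun x => (N x).[z] / D.[z]).
Proof.
case/(pf_subst (polyC : {rmorphism F -> {poly F}}) N D) => m [g Hg]; exists m, g => z.
move=> /= Dz; exact: (Hg (horner_eval z : {rmorphism _ -> _}) (fun c => hornerC c z) Dz).
Qed.

(** On the line through [e0] and [e1] both functions become univariate polynomials, one nonzero at 0
    and the other at 1. Their product has finitely many roots and the field is infinite. *)
Lemma pf_mul_neq0 A f g e0 e1 :
  (forall m : nat, m.+1%:R != 0 :> F) -> polyfun A f -> polyfun A g ->
  f e0 != 0 -> g e1 != 0 -> exists e, f e * g e != 0.
Proof.
move=> char0 Hf Hg f0 g0.
pose N x := (e0 x)%:P + (e1 x - e0 x) *: 'X.
have NE z x : (N x).[z] / (1 : {poly F}).[z] = e0 x + (e1 x - e0 x) * z.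
  by rewrite /N hornerD hornerZ hornerX !hornerC divr1.
have [m1 [p Hp]] := pf_univariate N 1 Hf; have [m2 [q Hq]] := pf_univariate N 1 Hg.
have e1E: forall z, (1 : {poly F}).[z] != 0 by move=> z; rewrite hornerC oner_eq0.
have p0: p != 0.
  apply: contraNneq f0 => p0; have := Hp 0 (e1E _); rewrite p0 horner0 [X in X ^+ m1]hornerC expr1n mul1r => /esym H.
  rewrite -H; apply/eqP/(pf_local Hf) => x _.
  by rewrite NE; ring.
have q0: q != 0.
  apply: contraNneq g0 => q0; have := Hq 1 (e1E _); rewrite q0 horner0 [X in X ^+ m2]hornerC expr1n mul1r => /esym H.
  rewrite -H; apply/eqP/(pf_local Hg) => x _.
  by rewrite NE; ring.
have [s Hs] := roots_list (mulf_neq0 p0 q0).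
have [z zs] := fresh_field char0 s.
exists (fun x => (N x).[z] / (1 : {poly F}).[z]).
apply: contraNneq zs => H; apply: Hs; rewrite /root hornerM Hp // Hq //.
by rewrite mulrACA H mulr0.
Qed.

Definition upd e x v : X -> F := fun z => if z == x then v else e z.

Lemma upd_same e x v : upd e x v x = v.
Proof. by rewrite /upd eqxx. Qed.

Lemma upd_other e x v z : z != x -> upd e x v z = e z.
Proof. by rewrite /upd => /negPf->. Qed.

(* Modulo the quadratic equation satisfied by the variable [x], every
   polynomial function becomes linear in [x]. *)
Lemma pf_quad_reduce A B f x al be ga :
  polyfun A f -> (forall z, A z -> B z \/ z = x) ->
  polyfun B al -> polyfun B be -> polyfun B ga ->
  exists m P R, [/\ polyfun B P, polyfun B R & forall e,
    al e * e x ^+ 2 + be e * e x + ga e = 0 -> al e ^+ m * f e = P e + R e * e x].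
Proof.
move=> Hf AB Ba Bb Bc.
elim: Hf => [c k E|z k Az E|k g h _ [m1 [P1 [R1 [HP1 HR1 H1]]]] _ [m2 [P2 [R2 [HP2 HR2 H2]]]] E
  |k g h _ [m1 [P1 [R1 [HP1 HR1 H1]]]] _ [m2 [P2 [R2 [HP2 HR2 H2]]]] E].
- exists 0, (fun=> c), (fun=> 0); split; try exact: pf_const.
  by move=> e _; rewrite E; ring.
- case: (AB _ Az) => [Bz|zx].
    exists 0, (fun e => e z), (fun=> 0); split; [exact: pf_var|exact: pf_const|].
    by move=> e _; rewrite E; ring.
  exists 0, (fun=> 0), (fun=> 1); split; try exact: pf_const.
  by move=> e _; rewrite E zx; ring.
- exists (m1 + m2)%N, (fun e => al e ^+ m2 * P1 e + al e ^+ m1 * P2 e),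
    (fun e => al e ^+ m2 * R1 e + al e ^+ m1 * R2 e).
  split; try by apply: pf_add; apply: pf_mul => //; apply: pf_exp.
  move=> e Q; rewrite E exprD.
  transitivity (al e ^+ m2 * (al e ^+ m1 * k e) + al e ^+ m1 * (al e ^+ m2 * g e)); first by ring.
  by rewrite H1 // H2 //; ring.
- exists (m1 + m2).+1, (fun e => al e * (P1 e * P2 e) - ga e * (R1 e * R2 e)),
    (fun e => al e * (P1 e * R2 e + P2 e * R1 e) - be e * (R1 e * R2 e)).
  split; try by repeat (exact || apply: pf_sub || apply: pf_mul || apply: pf_add).
  move=> e Q; rewrite E exprS exprD.
  transitivity (al e * ((al e ^+ m1 * k e) * (al e ^+ m2 * g e))); first by ring.
  rewrite H1 // H2 //; apply/eqP; rewrite -subr_eq0; apply/eqP.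
  rewrite -[RHS](mulr0 (R1 e * R2 e)) -[in RHS]Q; ring.
Qed.

(* [N] is the norm of [f] over the quadratic extension generated by [x]. *)
Lemma pf_quad_norm A B f x al be ga :
  polyfun A f -> (forall z, A z -> B z \/ z = x) -> ~ B x ->
  polyfun B al -> polyfun B be -> polyfun B ga ->
  exists N, [/\ polyfun B N,
    (forall e, al e * e x ^+ 2 + be e * e x + ga e = 0 -> f e = 0 -> N e = 0) &
    (forall e r0 r1, al e != 0 -> be e = - al e * (r0 + r1) -> ga e = al e * r0 * r1 ->
       f (upd e x r0) != 0 -> f (upd e x r1) != 0 -> N e != 0)].
Proof.
move=> Hf AB nBx Ba Bb Bc.
have [m [P [R [HP HR H]]]] := pf_quad_reduce Hf AB Ba Bb Bc.
(* This is [al * (P + R r0) * (P + R r1)], with the symmetric functions of the roots [r0], [r1]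
   expressed through the coefficients. *)
exists (fun e => al e * P e ^+ 2 - be e * (P e * R e) + ga e * R e ^+ 2); split.
- by repeat (exact || apply: pf_sub || apply: pf_mul || apply: pf_add || apply: pf_exp).
- move=> e Q f0; have := H e Q; rewrite f0 mulr0 => /esym/eqP; rewrite addr_eq0 => /eqP PE.
  by rewrite -[RHS](mulr0 (R e ^+ 2)) -[in RHS]Q PE; ring.
- move=> e r0 r1 a0 bE cE f0 f1.
  have loc g r : polyfun B g -> g (upd e x r) = g e.
    by move=> Hg; apply: (pf_local Hg) => z Bz; rewrite upd_other //; apply/eqP => zx; apply: nBx; rewrite -zx.
  have E r : al e * r ^+ 2 + be e * r + ga e = 0 -> f (upd e x r) != 0 -> P e + R e * r != 0.
    move=> Q fr; have := H (upd e x r); rewrite upd_same (loc al) // (loc be) // (loc ga) // (loc P) // (loc R) // => /(_ Q) <-.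
    by rewrite mulf_neq0 // expf_neq0.
  have -> : al e * P e ^+ 2 - be e * (P e * R e) + ga e * R e ^+ 2 =
    al e * ((P e + R e * r0) * (P e + R e * r1)) by rewrite bE cE; ring.
  by rewrite !mulf_neq0 //; apply: E => //; rewrite bE cE; ring.
Qed.

End PolyFun.

(** * Elimination of the apex parameters *)

Section Elimination.
Variables (F : fieldType) (K : eqType).
Hypothesis char0 : forall m : nat, m.+1%:R != 0 :> F.
Hypothesis sqrtF : forall a : F, exists b, b ^+ 2 = a.

Lemma quadratic_roots (a b c : F) : a != 0 ->
  exists r0 r1, b = - a * (r0 + r1) /\ c = a * r0 * r1.
Proof.
move=> a0; have [d dE] := sqrtF (b ^+ 2 - 4%:R * a * c).
have h2 : 2%:R != 0 :> F := char0 1.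
exists ((- b + d) / (2%:R * a)), ((- b - d) / (2%:R * a)); split; first by field; rewrite a0.
have -> : a * ((- b + d) / (2%:R * a)) * ((- b - d) / (2%:R * a)) = (b ^+ 2 - d ^+ 2) / (4%:R * a).
  by field; rewrite a0 (char0 3).
by rewrite dE; field; rewrite a0 (char0 3).
Qed.

(* The equation satisfied by the parameter [nu] of the apex of an interior
   triangle whose sides carry the cross-ratios [y] (upper side), [y1], [y2]. *)
Definition apexQ (y y1 y2 nu : F) :=
  (nu + y) * (nu + y1) - y2 * (nu + 1) * (nu + y * y1).

Definition apexDisc (y y1 y2 : F) :=
  (y + y1 - y2 * (1 + y * y1)) ^+ 2 - 4%:R * (1 - y2) ^+ 2 * (y * y1).

Lemma apexQE y y1 y2 nu : apexQ y y1 y2 nu =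
  (1 - y2) * nu ^+ 2 + (y + y1 - y2 * (1 + y * y1)) * nu + (1 - y2) * (y * y1).
Proof. by rewrite /apexQ; ring. Qed.

Lemma apexQ_linear y y1 y2 nu : apexQ y y1 y2 nu =
  y * (nu * (1 - y1 * y2) + y1 * (1 - y2)) + nu * (nu * (1 - y2) + (y1 - y2)).
Proof. by rewrite /apexQ; ring. Qed.

Lemma apexQ_roots y y1 y2 : y2 != 1 -> apexDisc y y1 y2 != 0 ->
  exists r0 r1, r0 != r1 /\ forall nu, apexQ y y1 y2 nu = 0 <-> nu = r0 \/ nu = r1.
Proof.
move=> y21 D0; have a0 : 1 - y2 != 0 by rewrite subr_eq0 eq_sym.
have [r0 [r1 [bE cE]]] := quadratic_roots (y + y1 - y2 * (1 + y * y1)) ((1 - y2) * (y * y1)) a0.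
exists r0, r1; split.
  apply: contraNneq D0 => r01; rewrite /apexDisc bE.
  have -> : 4%:R * (1 - y2) ^+ 2 * (y * y1) = 4%:R * (1 - y2) * ((1 - y2) * (y * y1)) by ring.
  by rewrite cE r01; apply/eqP; ring.
move=> nu; have -> : apexQ y y1 y2 nu = (1 - y2) * ((nu - r0) * (nu - r1)).
  by rewrite apexQE bE cE; ring.
split=> [/eqP|[->|->]]; last 2 first.
- by rewrite subrr mul0r mulr0.
- by rewrite subrr !mulr0.
by rewrite !mulf_eq0 (negPf a0) /= !subr_eq0 => /orP[]/eqP; [left|right].
Qed.

(* The denominator when [apexQ y y1 y2 nu = 0] is solved for [y]. *)
Lemma apexQ_den y y1 y2 nu : y1 != 0 -> y1 != 1 -> y2 != 0 -> y2 != 1 ->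
  apexQ y y1 y2 nu = 0 -> nu * (1 - y1 * y2) + y1 * (1 - y2) != 0.
Proof.
move=> y10 y11 y20 y21; rewrite apexQ_linear => Q; apply/eqP => D.
have a0 : 1 - y2 != 0 by rewrite subr_eq0 eq_sym.
move/eqP: Q; rewrite D mulr0 add0r mulf_eq0 => /orP[/eqP nu0|/eqP E].
  by move/eqP: D; rewrite nu0 mul0r add0r mulf_eq0 (negPf y10) (negPf a0).
(* Elimination of [nu] between the two linear relations [D] and [E]. *)
have : y2 * (1 - y1) ^+ 2 = 0.
  transitivity ((1 - y2) * (nu * (1 - y1 * y2) + y1 * (1 - y2))
     - (1 - y1 * y2) * (nu * (1 - y2) + (y1 - y2))); first by ring.
  by rewrite D E; ring.
by apply/eqP; rewrite mulf_neq0 // expf_neq0 // subr_eq0 eq_sym.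
Qed.

(* [inl k] is the cross-ratio of the label [k], [inr k] its apex parameter. *)
Notation env := ((K + K)%type -> F).
Implicit Types (e : env) (q : K * K * K).

Definition eqnQ e q := apexQ (e (inl q.1.1)) (e (inl q.1.2)) (e (inl q.2)) (e (inr q.1.1)).

Definition generic e := forall k, e (inl k) != 0 /\ e (inl k) != 1.

Definition vars (ks : seq K) (x : K + K) : Prop :=
  match x with inl _ => True | inr k => k \in ks end.

(** The norm of [f] over the quadratic equation of [q] does the elimination; the point is that it
    does not vanish identically. With all other coordinates frozen at [e0], the curve [apexQ = 0] is
    rational: [nu] is free and [y = A / D]. On it [f] is a nonzero rational function with finitely
    many zeros, so for almost every [y] both roots [nu] avoid them. *)
Lemma eliminate_one (ks : seq K) f q e0 :
  polyfun (vars (q.1.1 :: ks)) f -> q.1.1 \notin ks ->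
  q.1.1 != q.1.2 -> q.1.1 != q.2 -> generic e0 -> eqnQ e0 q = 0 -> f e0 != 0 ->
  exists N y, [/\ polyfun (vars ks) N, y != 0, y != 1, N (upd e0 (inl q.1.1) y) != 0 &
    forall e, generic e -> eqnQ e q = 0 -> f e = 0 -> N e = 0].
Proof.
case: q => [[k k1] k2] /= Hf kks kk1 kk2 G0; rewrite /eqnQ /= => Q0 f0.
set y1 := e0 (inl k1) in Q0 *; set y2 := e0 (inl k2) in Q0 *.
have [y10 y11] := G0 k1; have [y20 y21] := G0 k2.
rewrite -/y1 in y10 y11; rewrite -/y2 in y20 y21.
pose D : {poly F} := (1 - y1 * y2) *: 'X + (y1 * (1 - y2))%:P.
pose A : {poly F} := - ('X * ((1 - y2) *: 'X + (y1 - y2)%:P)).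
have DE z : D.[z] = z * (1 - y1 * y2) + y1 * (1 - y2).
  by rewrite /D hornerD hornerZ hornerX hornerC; ring.
have AE z : A.[z] = - (z * (z * (1 - y2) + (y1 - y2))).
  by rewrite /A hornerN hornerM hornerD hornerZ hornerX hornerC; ring.
(* Divided by [D], these numerators give the parametrization of the curve: [nu] is the variable, [y]
   is [A / D], and the rest is constant. *)
pose N (x : K + K) : {poly F} :=
  if x == inr k then 'X * D else if x == inl k then A else e0 x *: D.
have [m [g Hg]] := pf_univariate N D Hf.
have NE z y : apexQ y y1 y2 z = 0 ->
    g.[z] = D.[z] ^+ m * f (upd (upd e0 (inl k) y) (inr k) z).
  move=> Q; have D0 : D.[z] != 0 by rewrite DE (apexQ_den y10 y11 y20 y21 Q).
  rewrite Hg //; congr (_ * _); apply: (pf_local Hf) => x _.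
  rewrite /N /upd; case: (x == inr k); first by rewrite hornerM hornerX mulfK.
  case: (x == inl k); last by rewrite hornerZ mulfK.
  apply: (mulIf D0); rewrite mulfVK // AE DE.
  by move/eqP: Q; rewrite apexQ_linear addr_eq0 => /eqP ->.
have g0 : g != 0.
  apply: contraNneq f0 => g0; have := NE _ _ Q0; rewrite g0 horner0 => /esym/eqP.
  rewrite mulf_eq0 expf_eq0 DE (negPf (apexQ_den y10 y11 y20 y21 Q0)) andbF /= => /eqP <-.
  apply/eqP/(pf_local Hf) => x _; rewrite /upd.
  by case: eqP => [->|_] //; case: eqP => [->|_].
have [s Hs] := roots_list g0.
(* The values to avoid are 0, 1 and the upper cross-ratios lying below the zeros of [f] on the
   curve. *)
have [y yN] := fresh_field char0 ([:: 0; 1] ++ [seq A.[r] / D.[r] | r <- s]).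
move: yN; rewrite mem_cat !inE !negb_or => /andP[/andP[yn0 yn1] ys].
pose al e : F := 1 - e (inl k2).
pose be e : F := e (inl k) + e (inl k1) - e (inl k2) * (1 + e (inl k) * e (inl k1)).
pose ga e : F := (1 - e (inl k2)) * (e (inl k) * e (inl k1)).
have pv k' : polyfun (vars ks) (fun e : env => e (inl k')) by apply: pf_var.
have [|||||M [HM M1 M2]] := @pf_quad_norm F _ (vars (k :: ks)) (vars ks) f (inr k) al be ga Hf.
- move=> [z|z] /=; first by left.
  by rewrite inE => /orP[/eqP->|]; [right|left].
- by rewrite /=; apply/negP.
- by rewrite /al; apply: pf_sub => //; apply: pf_const.
- by repeat (exact || apply: pf_sub || apply: pf_mul || apply: pf_add || apply: pf_const).
- by repeat (exact || apply: pf_sub || apply: pf_mul || apply: pf_add || apply: pf_const).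
exists M, y; split => //; last first.
  by move=> e Ge Q fe; apply: M1 => //; rewrite -Q apexQE.
have E1 : upd e0 (inl k) y (inl k1) = y1.
  by rewrite upd_other //; apply: contraNneq kk1 => -[->].
have E2 : upd e0 (inl k) y (inl k2) = y2.
  by rewrite upd_other //; apply: contraNneq kk2 => -[->].
have a0 : 1 - y2 != 0 by rewrite subr_eq0 eq_sym.
have [r0 [r1 [bE cE]]] := quadratic_roots (y + y1 - y2 * (1 + y * y1)) ((1 - y2) * (y * y1)) a0.
have Hr r : apexQ y y1 y2 r = 0 -> f (upd (upd e0 (inl k) y) (inr k) r) != 0.
  move=> Q; apply: contraNneq ys => fr.
  have rs : r \in s by apply: Hs; rewrite /root (NE _ _ Q) fr mulr0.
  apply/mapP; exists r => //.
  have D0 : D.[r] != 0 by rewrite DE (apexQ_den y10 y11 y20 y21 Q).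
  apply: (mulIf D0); rewrite mulfVK // AE DE.
  by move/eqP: Q; rewrite apexQ_linear addr_eq0 => /eqP ->.
apply: (M2 _ r0 r1); rewrite ?/al ?/be ?/ga ?E1 ?E2 ?upd_same //; apply: Hr;
  by rewrite apexQE bE cE; ring.
Qed.

(* Each equation involves its own variable [q.1.1] and variables that occur
   only further down the list. *)
Fixpoint topdown (qs : seq (K * K * K)) : bool :=
  if qs is q :: qs' then
    [&& q.1.1 != q.1.2, q.1.1 != q.2,
        all (fun q' => (q.1.1 != q'.1.1) && (q.1.1 != q'.1.2) && (q.1.1 != q'.2)) qs' & topdown qs']
  else true.

Definition keys (qs : seq (K * K * K)) := [seq q.1.1 | q <- qs].

(** The norms are taken from the top of the list down. Each step changes the cross-ratio of the
    eliminated key, and [topdown] guarantees that no remaining equation involves it. Read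
    contrapositively, [g e != 0] makes [f] nonzero at [e] whenever [e] is a generic solution. *)
Lemma eliminate qs f e0 :
  topdown qs -> polyfun (vars (keys qs)) f -> generic e0 ->
  (forall q, q \in qs -> eqnQ e0 q = 0) -> f e0 != 0 ->
  exists g e1, [/\ polyfun (vars [::]) g, g e1 != 0 &
    forall e, generic e -> (forall q, q \in qs -> eqnQ e q = 0) -> f e = 0 -> g e = 0].
Proof.
elim: qs f e0 => [|q qs IH] f e0 /=; first by move=> _ Hf _ _ f0; exists f, e0.
move=> /and4P[q1 q2 /allP qqs td] Hf G0 Q0 f0.
have kks : q.1.1 \notin keys qs.
  by apply/mapP => -[q' /qqs /andP[/andP[+ _] _]] E; rewrite E eqxx.
have [N [y [HN y0 y1 N0 NP]]] := eliminate_one Hf kks q1 q2 G0 (Q0 _ (mem_head _ _)) f0.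
have [||g [e1 [Hg g1 gP]]] := IH N (upd e0 (inl q.1.1) y) td HN _ _ N0.
- by move=> k; rewrite /upd; case: ifP => _; [split|apply: G0].
- move=> q' q's; have /andP[/andP[a b] c] := qqs _ q's.
  rewrite /eqnQ !upd_other //; first by apply: Q0; rewrite inE q's orbT.
  + by apply: contraNneq c => -[->].
  + by apply: contraNneq b => -[->].
  + by apply: contraNneq a => -[->].
exists g, e1; split=> // e Ge Qe fe; apply: gP => //.
  by move=> q' q's; apply: Qe; rewrite inE q's orbT.
by apply: NP => //; apply: Qe; rewrite mem_head.
Qed.

End Elimination.

(** * Brackets and labelled trees *)

Section Brackets.
Variable F : fieldType.
Notation vec := (F * F)%type.
Implicit Types (a b c d s t u v w : vec) (x z : F).

Definition br u v : F := u.1 * v.2 - u.2 * v.1.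

Definition lin x u z v : vec := (x * u.1 + z * v.1, x * u.2 + z * v.2).

Definition scale x u : vec := (x * u.1, x * u.2).

(** Equality of points of the projective line. *)
Definition par u v := exists2 x, x != 0 & u = scale x v.

(** The equation giving the cross-ratio the value [x], cleared of denominators so that it also makes
    sense for degenerate points. *)
Definition cross a b c d x := br a c * br b d = x * (br a d * br b c).

Lemma br_linl x u z v w : br (lin x u z v) w = x * br u w + z * br v w.
Proof. by rewrite /br /=; ring. Qed.

Lemma br_anti u v : br v u = - br u v.
Proof. by rewrite /br; ring. Qed.

Lemma brxx u : br u u = 0.
Proof. by rewrite /br; ring. Qed.

Lemma br_scale x z u v : br (scale x u) (scale z v) = x * z * br u v.
Proof. by rewrite /br /=; ring. Qed.

(** With this [s] and [t] the equation of the left side, with value [y1], holds identically. The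
    equation of the right side is what remains, and modulo that of the upper side it is a multiple
    of the quadratic. *)
Lemma apexQ_cross a b c d y y1 y2 nu :
  let s := lin (br b d) a (nu * br a d) b in
  let t := lin (y1 * br b d) a (nu * br a d) b in
  cross a b c d y ->
  br s c * br t d - y2 * (br s d * br t c) =
  br a d ^+ 2 * br b c * br b d * apexQ y y1 y2 nu.
Proof.
move=> s t C; rewrite /s /t !br_linl.
have -> : br b d * br a c + nu * br a d * br b c = br a d * br b c * (y + nu).
  by rewrite [br b d * _]mulrC C; ring.
have -> : y1 * br b d * br a c + nu * br a d * br b c = br a d * br b c * (y1 * y + nu).
  by rewrite -[y1 * _ * _]mulrA [br b d * _]mulrC C; ring.
by rewrite /apexQ; ring.
Qed.

Section Apex.
Variables (al be ga de : F) (pa pb pc pd ps pt : vec) (y y1 y2 nu : F).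
Hypotheses (al0 : al != 0) (be0 : be != 0) (ga0 : ga != 0) (de0 : de != 0).

(** By Cramer's rule the brackets of [ps] with [pa] and [pb] are, up to sign and a common factor,
    its coordinates in the basis [pa], [pb]; the equation for [nu] fixes their ratio. The factors
    [al], [be], [de] allow arbitrary representatives of the given points. *)
Lemma par_apex_s :
  br pb ps != 0 -> br pa pd != 0 -> br pb pd != 0 -> br pa pb != 0 ->
  nu * (br pb ps * br pa pd) = - (br pa ps * br pb pd) ->
  let a := scale al pa in let b := scale be pb in let d := scale de pd in
  par (lin (br b d) a (nu * br a d) b) ps.
Proof.
move=> h1 h2 h3 h4 nuE; exists (- al * be * de * br pb pd * br pa pb / br pb ps).
  by rewrite !(mulf_neq0, invr_neq0, oppr_eq0).
have -> : nu = - (br pa ps * br pb pd) / (br pb ps * br pa pd).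
  by apply: (mulIf (mulf_neq0 h1 h2)); rewrite nuE mulfVK // mulf_neq0.
move: h1 h2; rewrite /lin !br_scale /scale /br /= => h1 h2.
by congr pair; field; rewrite h1 h2.
Qed.

Lemma par_apex_t :
  br pb ps != 0 -> br pa pd != 0 -> br pb pd != 0 -> br pa pb != 0 ->
  br pa pt != 0 -> br pa ps != 0 ->
  nu * (br pb ps * br pa pd) = - (br pa ps * br pb pd) ->
  cross pa pb ps pt y1 ->
  let a := scale al pa in let b := scale be pb in let d := scale de pd in
  par (lin (y1 * br b d) a (nu * br a d) b) pt.
Proof.
move=> h1 h2 h3 h4 h5 h6 nuE C.
exists (- al * be * de * br pb pd * br pa ps * br pa pb / (br pb ps * br pa pt)).
  by rewrite !(mulf_neq0, invr_neq0, oppr_eq0).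
have -> : nu = - (br pa ps * br pb pd) / (br pb ps * br pa pd).
  by apply: (mulIf (mulf_neq0 h1 h2)); rewrite nuE mulfVK // mulf_neq0.
have -> : y1 = br pa ps * br pb pt / (br pb ps * br pa pt).
  apply: (mulIf (mulf_neq0 h1 h5)); rewrite mulfVK ?mulf_neq0 //.
  by rewrite C; ring.
move: h1 h2 h5; rewrite /lin !br_scale /scale /br /= => h1 h2 h5.
by congr pair; field; rewrite h1 h2 h5.
Qed.

Lemma par_apex_right :
  br pb pc != 0 -> br pb pd != 0 -> br pc pd != 0 -> br pt pc != 0 ->
  cross pb pt pc pd y2 ->
  let b := scale be pb in let c := scale ga pc in let d := scale de pd in
  par (lin (y2 * br b d) c (- br b c) d) pt.
Proof.
move=> h1 h2 h3 h4 C; exists (be * ga * de * br pb pc * br pc pd / br pt pc).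
  by rewrite !(mulf_neq0, invr_neq0, oppr_eq0).
have -> : y2 = br pb pc * br pt pd / (br pb pd * br pt pc).
  by apply: (mulIf (mulf_neq0 h2 h4)); rewrite mulfVK ?mulf_neq0.
move: h2 h4; rewrite /lin !br_scale /scale /br /= => h2 h4.
by congr pair; field; rewrite h2 h4.
Qed.

Lemma par_apex_left :
  br pa pc != 0 -> br pb pc != 0 -> br pa pb != 0 -> br pb ps != 0 ->
  cross pa pb ps pc y1 ->
  let a := scale al pa in let b := scale be pb in let c := scale ga pc in
  par (lin (br b c) a (- (y1 * br a c)) b) ps.
Proof.
move=> h1 h2 h3 h4 C; exists (- al * be * ga * br pb pc * br pa pb / br pb ps).
  by rewrite !(mulf_neq0, invr_neq0, oppr_eq0).
have -> : y1 = br pa ps * br pb pc / (br pa pc * br pb ps).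
  by apply: (mulIf (mulf_neq0 h1 h4)); rewrite mulfVK ?mulf_neq0.
move: h1 h4; rewrite /lin !br_scale /scale /br /= => h1 h4.
by congr pair; field; rewrite h1 h4.
Qed.

End Apex.

(* The linear map sending [a], [b], [d] to multiples of [(1, 0)], [(0, 1)]
   and [(1, 1)]. *)
Definition frame a b d v : vec := (br v b * br d a, br v a * br d b).

Lemma br_frame a b d u v :
  br (frame a b d u) (frame a b d v) = - (br d a * br d b * br a b) * br u v.
Proof. by rewrite /frame /br /=; ring. Qed.

End Brackets.

(* The part of a triangulation cut off by a side: leaves are edges of the
   polygon, in cyclic order, and inner nodes are labelled by diagonals. *)
Inductive tree (E K : Type) := Leaf of E | Node of K & tree E K & tree E K.
Arguments Leaf {E K}.

Section Trees.
Variables (E K : Type).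
Implicit Types (t l r : tree E K).

Fixpoint leftmost t : E := match t with Leaf e => e | Node _ l _ => leftmost l end.

Fixpoint rightmost t : E := match t with Leaf e => e | Node _ _ r => rightmost r end.

Fixpoint leaves t : seq E :=
  match t with Leaf e => [:: e] | Node _ l r => leaves l ++ leaves r end.

Fixpoint labels t : seq K :=
  match t with Leaf _ => [::] | Node k l r => k :: labels l ++ labels r end.

(* Interior triangles, as triples of labels with the upper side first; upper
   triangles come before lower ones. *)
Fixpoint inner t : seq (K * K * K) :=
  match t with
  | Leaf _ => [::]
  | Node k l r =>
      (if (l, r) is (Node k1 _ _, Node k2 _ _) then [:: (k, k1, k2)] else [::])
      ++ inner l ++ inner r
  end.

End Trees.

Lemma leftmost_leaves (E : eqType) K (t : tree E K) : leftmost t \in leaves t.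
Proof. by elim: t => [e|k l IHl r IHr] /=; rewrite ?mem_head // mem_cat IHl. Qed.

Lemma rightmost_leaves (E : eqType) K (t : tree E K) : rightmost t \in leaves t.
Proof. by elim: t => [e|k l IHl r IHr] /=; rewrite ?mem_head // mem_cat IHr orbT. Qed.

Lemma ends_neq (E : eqType) K k (l r : tree E K) :
  uniq (leaves (Node k l r)) -> leftmost l != rightmost r.
Proof.
rewrite /= cat_uniq => /and3P[_ /hasPn H _].
by apply: contraTneq (leftmost_leaves l) => ->; apply/H/rightmost_leaves.
Qed.

(** * Configurations attached to a tree *)

Section Configurations.
Variables (F : fieldType) (E K : eqType).
Notation vec := (F * F)%type.
Notation tree := (tree E K).
Implicit Types (t l r : tree) (i j e : E) (p q : E -> vec) (y nu : K -> F) (a b c d : vec).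

(* [i] and [j] are the edges preceding and following the leaves of [t]. *)
Fixpoint sat y p t i j : Prop :=
  match t with
  | Leaf _ => True
  | Node k l r =>
      [/\ cross (p i) (p (leftmost l)) (p (rightmost r)) (p j) (y k),
          sat y p l i (leftmost r) & sat y p r (rightmost l) j]
  end.

(** At an interior triangle [nu k] is minus a cross-ratio of the points at [i], [j] and the two ends
    of [l]. It is obtained by solving [s = [bd] a + nu [ad] b] for [nu]. *)
Fixpoint apexes nu p t i j : Prop :=
  match t with
  | Leaf _ => True
  | Node k l r =>
      [/\ (if (l, r) is (Node _ _ _, Node _ _ _) then
             nu k * (br (p (leftmost l)) (p (rightmost l)) * br (p i) (p j)) =
             - (br (p i) (p (rightmost l)) * br (p (leftmost l)) (p j))
           else True),
          apexes nu p l i (leftmost r) & apexes nu p r (rightmost l) j]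
  end.

(* The two points at the apex of the triangle below [k], given the points
   [a], [b] and [c], [d] at the two ends of [k]. *)
Definition apex y nu k l r a b c d : vec * vec :=
  match l, r with
  | Leaf _, Leaf _ => (b, c)
  | Leaf _, Node k2 _ _ => (b, lin (y k2 * br b d) c (- br b c) d)
  | Node k1 _ _, Leaf _ => (lin (br b c) a (- (y k1 * br a c)) b, c)
  | Node k1 _ _, Node k2 _ _ =>
      (lin (br b d) a (nu k * br a d) b, lin (y k1 * br b d) a (nu k * br a d) b)
  end.

(** Each subtree receives the two points at either end of its top side: the left one lies between
    [a, b] and the apex pair, the right one between the apex pair and [c, d]. *)
Fixpoint bld y nu t a b c d e : vec :=
  match t with
  | Leaf _ => b
  | Node k l r =>
      let s := (apex y nu k l r a b c d).1 in
      let t' := (apex y nu k l r a b c d).2 in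
      if e \in leaves l then bld y nu l a b s t' e else bld y nu r s t' c d e
  end.

(* On a leaf, [b] and [c] are the same point. *)
Definition coherent y t a b c d : Prop :=
  match t with Leaf _ => b = c | Node k _ _ => cross a b c d (y k) end.

Definition solves y nu t := forall k, k \in inner t ->
  apexQ (y k.1.1) (y k.1.2) (y k.2) (nu k.1.1) = 0.

(** The linear combinations in [apex] solve the equation of one lower side identically. Only at an
    interior triangle is a second equation left, and there the quadratic is used. *)
Lemma coherent_apex y nu k l r a b c d :
  coherent y (Node k l r) a b c d -> solves y nu (Node k l r) ->
  let s := (apex y nu k l r a b c d).1 in
  let t := (apex y nu k l r a b c d).2 in
  coherent y l a b s t /\ coherent y r s t c d.
Proof.
move=> /= C S; case: l r S => [e|k1 l1 r1] [f|k2 l2 r2] S; split=> //=.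
- by rewrite /cross /lin /br /=; ring.
- by rewrite /cross /lin /br /=; ring.
- by rewrite /cross /lin /br /=; ring.
- have := S (k, k1, k2) (mem_head _ _) => /= Q.
  have := apexQ_cross (y k1) (y k2) (nu k) C; rewrite Q mulr0 => /eqP.
  by rewrite subr_eq0 => /eqP.
Qed.

Lemma solves_l y nu k l r : solves y nu (Node k l r) -> solves y nu l.
Proof. by move=> S q ql; apply: S; rewrite /= !mem_cat ql orbT. Qed.

Lemma solves_r y nu k l r : solves y nu (Node k l r) -> solves y nu r.
Proof. by move=> S q qr; apply: S; rewrite /= !mem_cat qr !orbT. Qed.

Lemma bld_ends y nu t a b c d : uniq (leaves t) -> coherent y t a b c d -> solves y nu t ->
  bld y nu t a b c d (leftmost t) = b /\ bld y nu t a b c d (rightmost t) = c.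
Proof.
elim: t a b c d => [e|k l IHl r IHr] a b c d //= U C S.
have [Cl Cr] := coherent_apex C S.
move: U; rewrite cat_uniq => /and3P[Ul /hasPn dj Ur].
rewrite leftmost_leaves (negPf (dj _ (rightmost_leaves r))).
have [-> _] := IHl _ _ _ _ Ul Cl (solves_l S).
by have [_ ->] := IHr _ _ _ _ Ur Cr (solves_r S).
Qed.

(** Besides solving the equations, the constructed points determine [nu]; this is what separates the
    configurations coming from different choices of roots. *)
Lemma bld_sat y nu t a b c d p i j :
  uniq (leaves t) -> coherent y t a b c d -> solves y nu t ->
  (forall e, e \in leaves t -> p e = bld y nu t a b c d e) -> p i = a -> p j = d ->
  sat y p t i j /\ apexes nu p t i j.
Proof.
elim: t a b c d i j => [e|k l IHl r IHr] a b c d i j //= U C S P pi pj.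
have [Cl Cr] := coherent_apex C S.
move: U; rewrite cat_uniq => /and3P[Ul /hasPn dj Ur].
set s := (apex _ _ _ _ _ _ _ _ _).1 in Cl Cr P.
set t := (apex _ _ _ _ _ _ _ _ _).2 in Cl Cr P.
have Pl e : e \in leaves l -> p e = bld y nu l a b s t e.
  by move=> el; rewrite P ?el // mem_cat el.
have Pr e : e \in leaves r -> p e = bld y nu r s t c d e.
  by move=> er; rewrite P ?mem_cat ?er ?orbT // (negPf (dj _ er)).
have [bl cl] := bld_ends Ul Cl (solves_l S); have [b_r cr] := bld_ends Ur Cr (solves_r S).
have p_lm : p (leftmost l) = b by rewrite Pl ?leftmost_leaves.
have p_s : p (rightmost l) = s by rewrite Pl ?rightmost_leaves.
have p_t : p (leftmost r) = t by rewrite Pr ?leftmost_leaves.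
have p_rm : p (rightmost r) = c by rewrite Pr ?rightmost_leaves.
have [sl al] := IHl _ _ _ _ i (leftmost r) Ul Cl (solves_l S) Pl pi p_t.
have [sr ar] := IHr _ _ _ _ (rightmost l) j Ur Cr (solves_r S) Pr p_s pj.
split; first by split=> //; rewrite pi pj p_lm p_rm.
split=> //; rewrite pi pj p_lm p_s /s.
by case: (l) (r) => [?|???] [?|???] //=; rewrite /lin /br /=; ring.
Qed.

Definition generic_conf p := forall e f, e != f -> br (p e) (p f) != 0.

(** Converse of [bld_sat]. Going down the tree, the equations force both apex points up to scaling.
    The quadratic follows from [apexQ_cross], whose other factors are brackets of distinct
    points. *)
Lemma bld_par y nu t a b c d p i j : generic_conf p ->
  uniq (leaves t) -> i \notin leaves t -> j \notin leaves t -> i != j ->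
  sat y p t i j -> apexes nu p t i j ->
  par a (p i) -> par b (p (leftmost t)) -> par c (p (rightmost t)) -> par d (p j) ->
  solves y nu t /\ forall e, e \in leaves t -> par (bld y nu t a b c d e) (p e).
Proof.
move=> G; elim: t a b c d i j => [e0|k l IHl r IHr] a b c d i j.
  by move=> _ _ _ _ _ _ _ hb _ _; split=> // e; rewrite mem_seq1 => /eqP->.
rewrite /= cat_uniq !mem_cat !negb_or => /and3P[Ul /hasPn dj Ur] /andP[il ir] /andP[jl jr] ij
  [C Sl Sr] [nuE Al Ar] Pa Pb Pc Pd.
have neq e f (s1 : seq E) : e \notin s1 -> f \in s1 -> e != f.
  by move=> es fs; apply: contraNneq es => ->.
have lr e f : e \in leaves l -> f \in leaves r -> e != f.
  by move=> el fr; apply: contraTneq el => ->; apply: dj.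
have ml := leftmost_leaves l; have Ml := rightmost_leaves l.
have mr := leftmost_leaves r; have Mr := rightmost_leaves r.
set s := (apex y nu k l r a b c d).1; set t := (apex y nu k l r a b c d).2.
have [Ps Pt] : par s (p (rightmost l)) /\ par t (p (leftmost r)).
  have [al al0 aE] := Pa; have [be be0 bE] := Pb; have [ga ga0 cE] := Pc; have [de de0 dE] := Pd.
  rewrite /s /t aE bE cE dE {s t IHl IHr Pa Pb Pc Pd aE bE cE dE}.
  case: l r Ul Ur il ir jl jr C Sl Sr nuE Al Ar ml Ml mr Mr lr dj => [e|k1 l1 r1] [f|k2 l2 r2]
    Ul Ur il ir jl jr C Sl Sr nuE Al Ar ml Ml mr Mr lr dj; rewrite [apex _ _ _ _ _ _ _ _ _]/=.
  - by split; [exists be|exists ga].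
  - split; first by exists be.
    case: Sr => Cr _ _; apply: par_apex_right => //; apply: G.
    + exact: lr.
    + by rewrite eq_sym (neq _ _ _ jl).
    + by rewrite eq_sym (neq _ _ _ jr).
    + exact: ends_neq Ur.
  - split; last by exists ga.
    case: Sl => Cl _ _; apply: par_apex_left => //; apply: G.
    + exact: neq Mr.
    + exact: lr.
    + exact: neq ml.
    + exact: ends_neq Ul.
  - case: Sl => Cl _ _; split.
      apply: par_apex_s => //; apply: G => //.
      + exact: ends_neq Ul.
      + by rewrite eq_sym (neq _ _ _ jl).
      + exact: neq ml.
    apply: par_apex_t Cl => //; apply: G => //.
    + exact: ends_neq Ul.
    + by rewrite eq_sym (neq _ _ _ jl).
    + exact: neq ml.
    + exact: neq mr.
    + exact: neq Ml.
have [||Vl Bl] := IHl a b s t i (leftmost r) Ul il _ _ Sl Al Pa Pb Ps Pt.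
- exact: dj.
- exact: neq mr.
have [||Vr Br] := IHr s t c d (rightmost l) j Ur _ jr _ Sr Ar Ps Pt Pc Pd.
- by apply/negP => /dj /negP; apply.
- by rewrite eq_sym (neq _ _ _ jl).
split=> [q|e]; last first.
  by rewrite mem_cat; case: ifP => [el _|_ /= er]; [apply: Bl|apply: Br].
rewrite mem_cat mem_cat => /orP[|/orP[/Vl|/Vr]] // ql.
have [k1 [l1 [r1 [k2 [l2 [r2 [El Er ->]]]]]]] : exists k1 l1 r1 k2 l2 r2,
    [/\ l = Node k1 l1 r1, r = Node k2 l2 r2 & q = (k, k1, k2)].
  case: (l) (r) ql => [?|k1 l1 r1] [?|k2 l2 r2] //.
  by rewrite mem_seq1 => /eqP->; exists k1, l1, r1, k2, l2, r2.
have [al al0 aE] := Pa; have [be be0 bE] := Pb; have [ga ga0 cE] := Pc; have [de de0 dE] := Pd.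
have Cab : cross a b c d (y k).
  rewrite aE bE cE dE /cross !br_scale.
  transitivity (al * be * ga * de * (br (p i) (p (rightmost r)) * br (p (leftmost l)) (p j))); first by ring.
  by rewrite C; ring.
have Cst : cross s t c d (y k2).
  have [si si0 sE] := Ps; have [ta ta0 tE] := Pt.
  have Cr : cross (p (rightmost l)) (p (leftmost r)) (p (rightmost r)) (p j) (y k2).
    by move: Sr; rewrite Er => -[].
  rewrite sE tE cE dE /cross !br_scale.
  transitivity (si * ta * ga * de * (br (p (rightmost l)) (p (rightmost r)) * br (p (leftmost r)) (p j))); first by ring.
  by rewrite Cr; ring.
have := apexQ_cross (y k1) (y k2) (nu k) Cab.
have -> : lin (br b d) a (nu k * br a d) b = s by rewrite /s El Er.
have -> : lin (y k1 * br b d) a (nu k * br a d) b = t by rewrite /t El Er.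
rewrite Cst subrr => /esym/eqP; rewrite mulf_eq0 => /orP[|/eqP //].
rewrite aE bE cE dE !br_scale expr2 !mulf_eq0.
rewrite (negPf al0) (negPf be0) (negPf ga0) (negPf de0) /=.
rewrite (negPf (G _ _ ij)) (negPf (G _ _ (lr _ _ ml Mr))) /=.
by rewrite (negPf (G _ _ _)) // eq_sym (neq _ _ _ jl).
Qed.

End Configurations.

(** * Moebius equivalence and normalization at the root triangle *)

Section Similarity.
Variables (F : fieldType) (E K : eqType).
Notation vec := (F * F)%type.
Notation tree := (tree E K).
Implicit Types (t l r : tree) (i j e : E) (p q : E -> vec) (y nu : K -> F) (a b c d : vec).

(* [p] and [q] represent configurations in the same Moebius class. *)
Definition sim p q := exists x (c : E -> F),
  [/\ x != 0, (forall e, c e != 0) &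
      forall e f, br (p e) (p f) = x * c e * c f * br (q e) (q f)].

Lemma sim_sym p q : sim p q -> sim q p.
Proof.
move=> [x [c [x0 c0 H]]]; exists x^-1, (fun e => (c e)^-1); split.
- by rewrite invr_eq0.
- by move=> e; rewrite invr_eq0.
- by move=> e f; rewrite H; field; rewrite x0 !c0.
Qed.

Lemma sim_trans p q p' : sim p q -> sim q p' -> sim p p'.
Proof.
move=> [x [c [x0 c0 H]]] [z [d [z0 d0 H']]]; exists (x * z), (fun e => c e * d e); split.
- exact: mulf_neq0.
- by move=> e; rewrite mulf_neq0.
- by move=> e f; rewrite H H'; ring.
Qed.

Lemma sim_par p q : (forall e, par (p e) (q e)) -> sim p q.
Proof.
move=> PP; pose good f x := x != 0 /\ p f = scale x (q f).
pose c f := epsilon (inhabits 0) (good f).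
have Hc f : c f != 0 /\ p f = scale (c f) (q f).
  by apply: (epsilon_spec (inhabits 0) (good f)); have [x x0 xE] := PP f; exists x.
exists 1, c; split=> [|f|f g]; first exact: oner_neq0; first by have [] := Hc f.
by have [_ ->] := Hc f; have [_ ->] := Hc g; rewrite br_scale mul1r.
Qed.

Lemma sim_frame p a b d : br d a != 0 -> br d b != 0 -> br a b != 0 ->
  sim (fun e => frame a b d (p e)) p.
Proof.
move=> da db ab; exists (- (br d a * br d b * br a b)), (fun=> 1); split.
- by rewrite oppr_eq0 !mulf_neq0.
- by move=> _; apply: oner_neq0.
- by move=> f g; rewrite br_frame; ring.
Qed.

Lemma par_frame_a a b d : br d a != 0 -> br a b != 0 -> par (1, 0) (frame a b d a).
Proof.
move=> da ab; exists (br a b * br d a)^-1; first by rewrite invr_eq0 mulf_neq0.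
by rewrite /frame /scale /= brxx mul0r mulr0 mulVf // mulf_neq0.
Qed.

Lemma par_frame_b a b d : br d b != 0 -> br a b != 0 -> par (0, 1) (frame a b d b).
Proof.
move=> db ab; have ba : br b a != 0 by rewrite br_anti oppr_eq0.
exists (br b a * br d b)^-1; first by rewrite invr_eq0 mulf_neq0.
by rewrite /frame /scale /= brxx mul0r mulr0 mulVf // mulf_neq0.
Qed.

Lemma par_frame_d a b d : br d a != 0 -> br d b != 0 -> par (1, 1) (frame a b d d).
Proof.
move=> da db; exists (br d b * br d a)^-1; first by rewrite invr_eq0 mulf_neq0.
by rewrite /frame /scale /= [br d a * br d b]mulrC mulVf // mulf_neq0.
Qed.

Lemma sim_cross p q e f g h x : sim p q ->
  cross (q e) (q f) (q g) (q h) x -> cross (p e) (p f) (p g) (p h) x.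
Proof.
move=> [z [c [_ _ H]]] C; rewrite /cross !H.
transitivity (z ^+ 2 * c e * c f * c g * c h * (br (q e) (q g) * br (q f) (q h))); first by ring.
by rewrite C; ring.
Qed.

Lemma sim_sat p q y t i j : sim p q -> sat y q t i j -> sat y p t i j.
Proof.
move=> S; elim: t i j => [//|k l IHl r IHr] i j /= [C sl sr]; split; last 2 first.
- exact: IHl.
- exact: IHr.
exact: sim_cross S C.
Qed.

Lemma sim_apexes p q nu t i j : sim p q -> apexes nu q t i j -> apexes nu p t i j.
Proof.
move=> S; elim: t i j => [//|k l IHl r IHr] i j [C al ar]; split; last 2 first.
- exact: IHl.
- exact: IHr.
have [z [c [_ _ H]]] := S; move: C.
case: (l) (r) => [?|k1 l1 r1] [?|k2 l2 r2] //; rewrite !H.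
set A := br (q _) _; set B := br (q i) (q j); set C := br (q i) _; set D := br _ (q j) => nuE.
set u := c _; set v := c _; set w := c i.
transitivity (z ^+ 2 * u * v * w * c j * (nu k * (A * B))); first by rewrite /u /v /w; ring.
by rewrite nuE; ring.
Qed.

Lemma apexes_local p nu nu' t i j :
  (forall k, k \in keys (inner t) -> nu k = nu' k) -> apexes nu p t i j -> apexes nu' p t i j.
Proof.
elim: t i j => [//|k l IHl r IHr] i j; rewrite /= /keys => N [C al ar]; split.
- move: N C; case: (l) (r) => [?|k1 l1 r1] [?|k2 l2 r2] // <- //; exact: mem_head.
- by apply: IHl => // k' kl; apply: N; rewrite !map_cat !mem_cat [X in _ || (X || _)]kl orbT.
- by apply: IHr => // k' kr; apply: N; rewrite !map_cat !mem_cat [X in _ || (_ || X)]kr !orbT.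
Qed.

(** Genericity permits the division defining each [nu k], and the distinctness of the keys makes the
    values from the two subtrees compatible. *)
Lemma apexes_exists p t i j : generic_conf p -> uniq (keys (inner t)) ->
  uniq (leaves t) -> i \notin leaves t -> j \notin leaves t -> i != j ->
  exists nu, apexes nu p t i j.
Proof.
move=> G; elim: t i j => [e|k l IHl r IHr] i j; first by exists (fun=> 0).
rewrite /= /keys !map_cat !cat_uniq => /and3P[_ /hasPn kh /and3P[Kl /hasPn klr Kr]].
move=> /and3P[Ul /hasPn dj Ur]; rewrite !mem_cat !negb_or => /andP[il ir] /andP[jl jr] ij.
have neq e f (s1 : seq E) : e \notin s1 -> f \in s1 -> e != f.
  by move=> es fs; apply: contraNneq es => ->.
have [||nl Hl] := IHl i (leftmost r) Kl Ul il.
- exact/dj/leftmost_leaves.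
- exact: neq (leftmost_leaves r).
have [||nr Hr] := IHr (rightmost l) j Kr Ur _ jr.
- by apply/negP => /dj /negP; apply; apply: rightmost_leaves.
- by rewrite eq_sym (neq _ _ _ jl) // rightmost_leaves.
pose v := - (br (p i) (p (rightmost l)) * br (p (leftmost l)) (p j)) /
   (br (p (leftmost l)) (p (rightmost l)) * br (p i) (p j)).
exists (fun k' => if k' \in keys (inner l) then nl k' else
                  if k' \in keys (inner r) then nr k' else v); split.
- move: kh Ul il ir jl dj @v; case: (l) (r) => [?|k1 l1 r1] [?|k2 l2 r2] // kh Ul il ir jl dj v.
  case: ifP => [kl|_].
    have kk : k \notin [:: k] by apply: (kh k); rewrite mem_cat; apply/orP; left.
    by rewrite mem_head in kk.
  case: ifP => [kr|_].
    have kk : k \notin [:: k] by apply: (kh k); rewrite mem_cat; apply/orP; right.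
    by rewrite mem_head in kk.
  rewrite /v mulfVK // mulf_neq0 //; apply: G => //.
  exact: ends_neq Ul.
- by apply: apexes_local Hl => k' kl; rewrite [X in if X then _ else _]kl.
- apply: apexes_local Hr => k' kr; rewrite ifF.
    by rewrite [X in if X then _ else _]kr.
  by apply/negbTE/klr.
Qed.

Lemma apexes_unique p nu nu' t i j : generic_conf p ->
  uniq (leaves t) -> i \notin leaves t -> j \notin leaves t -> i != j ->
  apexes nu p t i j -> apexes nu' p t i j ->
  forall k, k \in keys (inner t) -> nu k = nu' k.
Proof.
move=> G; elim: t i j => [e|k l IHl r IHr] i j //.
rewrite /= /keys !map_cat !cat_uniq => /and3P[Ul /hasPn dj Ur].
rewrite !mem_cat !negb_or => /andP[il ir] /andP[jl jr] ij [C al ar] [C' al' ar'] k'.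
have neq e f (s1 : seq E) : e \notin s1 -> f \in s1 -> e != f.
  by move=> es fs; apply: contraNneq es => ->.
rewrite !mem_cat => /orP[|/orP[kl|kr]]; last 2 first.
- apply: (IHl i (leftmost r)) => //; first exact/dj/leftmost_leaves.
  exact: neq (leftmost_leaves r).
- apply: (IHr (rightmost l) j) => //.
    by apply/negP => /dj /negP; apply; apply: rightmost_leaves.
  by rewrite eq_sym (neq _ _ _ jl) // rightmost_leaves.
move: Ul C C'; case: (l) (r) => [?|k1 l1 r1] [?|k2 l2 r2] // Ul C C'.
rewrite mem_seq1 => /eqP->; move: C; rewrite -C'; apply: mulIf; rewrite mulf_neq0 //; apply: G => //.
exact: ends_neq Ul.
Qed.

(* The root triangle has the sides [l], [r] and the edge [e]. *)
Definition rsat y p l r e := sat y p l e (leftmost r) /\ sat y p r (rightmost l) e.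

Definition rapexes nu p l r e :=
  apexes nu p l e (leftmost r) /\ apexes nu p r (rightmost l) e.

(* Normalization at the root triangle: the points of [e], of the leftmost leaf
   of [l] and of the leftmost leaf of [r] are put at infinity, 0 and 1. *)
Definition root_a : vec := (1, 0).
Definition root_b : vec := (0, 1).
(** The point of the rightmost leaf of [l]: the equation of the top side of [l] determines it from
    the three normalized points. If [l] is a leaf, its two ends coincide. *)
Definition root_c y l : vec := if l is Node k _ _ then (1, y k) else root_b.
Definition root_d : vec := (1, 1).
(** The point of the rightmost leaf of [r], found from the equation of the top side of [r]; the
    formula is that of [apex] for a left node and a right leaf. *)
Definition root_q y l r : vec :=
  if r is Node k _ _ then
    lin (br root_d root_a) (root_c y l) (- (y k * br (root_c y l) root_a)) root_d
  else root_d.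

Definition rconf y nu l r e : E -> vec := fun e' =>
  if e' == e then root_a else
  if e' \in leaves l then bld y nu l root_a root_b (root_c y l) root_d e'
  else bld y nu r (root_c y l) root_d (root_q y l r) root_a e'.

Lemma root_coherent y l r :
  coherent y l root_a root_b (root_c y l) root_d /\
  coherent y r (root_c y l) root_d (root_q y l r) root_a.
Proof.
split; first by case: l => [?|k l1 r1] //=; rewrite /cross /br /=; ring.
rewrite /root_q; case: r => [?|k l1 r1] //=.
by rewrite /cross /lin /br /=; ring.
Qed.

Lemma rconf_sat y nu l r e : uniq (e :: leaves l ++ leaves r) ->
  solves y nu l -> solves y nu r ->
  rsat y (rconf y nu l r e) l r e /\ rapexes nu (rconf y nu l r e) l r e.
Proof.
rewrite /= mem_cat negb_or cat_uniq => /andP[/andP[el er] /and3P[Ul /hasPn dj Ur]] Sl Sr.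
have [Cl Cr] := root_coherent y l r.
set P := rconf y nu l r e.
have Pe : P e = root_a by rewrite /P /rconf eqxx.
have Pl f : f \in leaves l -> P f = bld y nu l root_a root_b (root_c y l) root_d f.
  by move=> fl; rewrite /P /rconf fl ifF //; apply: contraNF el => /eqP <-.
have Pr f : f \in leaves r -> P f = bld y nu r (root_c y l) root_d (root_q y l r) root_a f.
  by move=> fr; rewrite /P /rconf (negPf (dj _ fr)) ifF //; apply: contraNF er => /eqP <-.
have [_ p_s] := bld_ends Ul Cl Sl; have [p_t _] := bld_ends Ur Cr Sr.
rewrite -Pl ?rightmost_leaves // in p_s; rewrite -Pr ?leftmost_leaves // in p_t.
have [sl al] := bld_sat Ul Cl Sl Pl Pe p_t.
by have [sr ar] := bld_sat Ur Cr Sr Pr p_s Pe.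
Qed.

(** The map [frame] moves three points of [p] to the normalized positions without changing the
    class. The equations of the two top sides then fix [root_c] and [root_q], and [bld_par] applies
    to each half. *)
Lemma rconf_sim y nu l r e p : generic_conf p ->
  uniq (e :: leaves l ++ leaves r) -> (forall f, f \in e :: leaves l ++ leaves r) ->
  rsat y p l r e -> rapexes nu p l r e ->
  [/\ solves y nu l, solves y nu r & sim (rconf y nu l r e) p].
Proof.
move=> G U full [sl sr] [al ar].
move: (U); rewrite /= mem_cat negb_or cat_uniq => /andP[/andP[el er] /and3P[Ul /hasPn dj Ur]].
have neq g f (s1 : seq E) : g \notin s1 -> f \in s1 -> g != f.
  by move=> es fs; apply: contraNneq es => ->.
have lr g f : g \in leaves l -> f \in leaves r -> g != f.
  by move=> gl fr; apply: contraTneq gl => ->; apply: dj.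
have ml := leftmost_leaves l; have Ml := rightmost_leaves l.
have mr := leftmost_leaves r; have Mr := rightmost_leaves r.
pose a := p e; pose b := p (leftmost l); pose d := p (leftmost r).
have da : br d a != 0 by apply: G; rewrite eq_sym (neq _ _ _ er).
have ab : br a b != 0 by apply: G; rewrite (neq _ _ _ el).
have db : br d b != 0 by apply: G; rewrite eq_sym lr.
pose q f := frame a b d (p f).
have Sq : sim q p by apply: sim_frame.
have Gq : generic_conf q.
  by move=> f g /G fg; rewrite br_frame !mulf_neq0 // oppr_eq0 !mulf_neq0.
have Pa : par root_a (q e) by apply: par_frame_a.
have Pb : par root_b (q (leftmost l)) by apply: par_frame_b.
have Pd : par root_d (q (leftmost r)) by apply: par_frame_d.
have slq := sim_sat Sq sl; have srq := sim_sat Sq sr.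
have alq := sim_apexes Sq al; have arq := sim_apexes Sq ar.
have Pc : par (root_c y l) (q (rightmost l)).
  rewrite /root_c; case El: l => [f|k l1 r1]; first by rewrite El in Pb.
  move: (Ul) sl; rewrite El => U1 [C _ _]; set c := p (rightmost r1).
  have bE : p (leftmost l1) = b by rewrite /b El.
  have cb : br c b != 0 by rewrite br_anti oppr_eq0 -bE; apply: G; exact: ends_neq U1.
  have yE : y k = br c a * br d b / (br c b * br d a).
    apply: (mulIf (mulf_neq0 cb da)); rewrite mulfVK ?mulf_neq0 //.
    have -> : br c a * br d b = br a c * br b d by rewrite /br; ring.
    by rewrite -bE in cb *; rewrite C -/a -/c -/d /br; ring.
  exists (br c b * br d a)^-1; first by rewrite invr_eq0 mulf_neq0.
  by rewrite /q /frame /scale [rightmost _]/= -/c /= mulVf ?mulf_neq0 // yE mulrC.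
have Pq : par (root_q y l r) (q (rightmost r)).
  move: srq Ur Pd mr Mr lr er; rewrite /root_q; case: (r) => [//|k l1 r1] [C _ _] U1 Pd1 mr1 Mr1 lr1 er1.
  have [al' al0 ->] := Pc; have [ga ga0 ->] := Pa; have [be be0 ->] := Pd1.
  apply: par_apex_left C => //; apply: Gq.
  - by rewrite eq_sym (neq _ _ _ el).
  - by rewrite eq_sym (neq _ _ _ er1).
  - exact: lr1.
  - exact: ends_neq U1.
have er' : leftmost r \notin leaves l by apply: dj.
have lr' : rightmost l \notin leaves r by apply/negP => /dj /negP; apply.
have e_t : e != leftmost r by apply: neq mr.
have s_e : rightmost l != e by rewrite eq_sym (neq _ _ _ el).
have [Vl Bl] := bld_par Gq Ul el er' e_t slq alq Pa Pb Pc Pd.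
have [Vr Br] := bld_par Gq Ur lr' er s_e srq arq Pc Pd Pq Pa.
split=> //; apply: sim_trans Sq.
apply: sim_par => f; have := full f; rewrite /rconf inE mem_cat; case: eqP => [-> //|_] /=.
by case: ifP => [fl _|_ fr]; [apply: Bl|apply: Br].
Qed.

End Similarity.

(** * Counting configurations for generic cross-ratios *)

Section PolyConf.
Variables (F : fieldType) (E K : eqType).
Notation env := ((K + K)%type -> F).
Notation vec := (F * F)%type.
Notation tree := (tree E K).
Implicit Types (l r t : tree) (a b c d u v : env -> vec).
Variable A : K + K -> Prop.
Hypothesis Ainl : forall k, A (inl k).

Definition pvec (v : env -> vec) :=
  polyfun A (fun e => (v e).1) /\ polyfun A (fun e => (v e).2).

Lemma pvec_const (w : vec) : pvec (fun=> w).
Proof. by split; apply: pf_const. Qed.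

Lemma pf_br u v : pvec u -> pvec v -> polyfun A (fun e => br (u e) (v e)).
Proof. by move=> [? ?] [? ?]; apply: pf_sub; apply: pf_mul. Qed.

Lemma pvec_lin x u z v : polyfun A x -> polyfun A z -> pvec u -> pvec v ->
  pvec (fun e => lin (x e) (u e) (z e) (v e)).
Proof. by move=> ? ? [? ?] [? ?]; split; apply: pf_add; apply: pf_mul. Qed.

Lemma pf_inl k : polyfun A (fun e : env => e (inl k)).
Proof. exact: pf_var. Qed.

Lemma pvec_apex k l r a b c d : pvec a -> pvec b -> pvec c -> pvec d ->
  (forall q, q \in inner (Node k l r) -> A (inr q.1.1)) ->
  let ap e := apex (e \o inl) (e \o inr) k l r (a e) (b e) (c e) (d e) in
  pvec (fun e => (ap e).1) /\ pvec (fun e => (ap e).2).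
Proof.
move=> Pa Pb Pc Pd; case: l r => [x|k1 l1 r1] [z|k2 l2 r2] N /=; split=> //.
- apply: pvec_lin => //; last by apply/pf_opp/pf_br.
  by apply: pf_mul; [apply: pf_inl|apply: pf_br].
- apply: pvec_lin => //; first exact: pf_br.
  by apply/pf_opp/pf_mul; [apply: pf_inl|apply: pf_br].
- apply: pvec_lin => //; first exact: pf_br.
  by apply: pf_mul; [apply/pf_var/(N (k, k1, k2))/mem_head|apply: pf_br].
- apply: pvec_lin => //.
    by apply: pf_mul; [apply: pf_inl|apply: pf_br].
  by apply: pf_mul; [apply/pf_var/(N (k, k1, k2))/mem_head|apply: pf_br].
Qed.

Lemma pvec_bld t a b c d f : pvec a -> pvec b -> pvec c -> pvec d ->
  (forall q, q \in inner t -> A (inr q.1.1)) ->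
  pvec (fun e => bld (e \o inl) (e \o inr) t (a e) (b e) (c e) (d e) f).
Proof.
elim: t a b c d => [x|k l IHl r IHr] a b c d Pa Pb Pc Pd N //=.
have [Ps Pt] := pvec_apex Pa Pb Pc Pd N.
case: (f \in leaves l).
- by apply: IHl => // q ql; apply: N; rewrite /= !mem_cat ql orbT.
- by apply: IHr => // q qr; apply: N; rewrite /= !mem_cat qr !orbT.
Qed.

(** The construction contains no division. Distinctness of the constructed points is therefore a
    polynomial condition on [y] and [nu], to which the elimination applies. *)
Lemma pvec_rconf (l r : tree) (x f : E) :
  (forall q, q \in inner l ++ inner r -> A (inr q.1.1)) ->
  pvec (fun e => rconf (e \o inl) (e \o inr) l r x f).
Proof.
move=> N.
have Pc : pvec (fun e : env => root_c (e \o inl) l).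
  rewrite /root_c; case: (l) => [z|k l1 r1]; first exact: pvec_const.
  by split; [apply: pf_const|apply: pf_inl].
have Pq : pvec (fun e : env => root_q (e \o inl) l r).
  rewrite /root_q; case: (r) => [z|k l1 r1]; first exact: pvec_const.
  apply: pvec_lin => //; [exact: pf_const| |exact: pvec_const].
  by apply/pf_opp/pf_mul; [apply: pf_inl|apply: pf_br => //; apply: pvec_const].
rewrite /rconf; case: (f == x); first exact: pvec_const.
by case: (f \in leaves l); apply: pvec_bld; try exact: pvec_const; try done;
  move=> q qs; apply: N; rewrite mem_cat qs ?orbT.
Qed.

End PolyConf.

(** * Classes of solutions over an open set of cross-ratios *)

Section Count.
Variables (F : fieldType) (E K : finType).
Hypothesis char0 : forall m : nat, m.+1%:R != 0 :> F.
Hypothesis sqrtF : forall a : F, exists b, b ^+ 2 = a.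
Notation env := ((K + K)%type -> F).
Notation vec := (F * F)%type.
Notation tree := (tree E K).

Definition env_of (y nu : K -> F) : env := fun x => match x with inl k => y k | inr k => nu k end.

Lemma topdown_uniq (qs : seq (K * K * K)) : topdown qs -> uniq (keys qs).
Proof.
elim: qs => [//|q qs IH] /and4P[_ _ /allP H td] /=; rewrite IH // andbT.
by apply/mapP => -[q' /H /andP[/andP[+ _] _]] E'; rewrite E' eqxx.
Qed.

Lemma disc_prod (qs : seq (K * K * K)) : topdown qs ->
  let D (e : env) := \prod_(q <- qs) apexDisc (e (inl q.1.1)) (e (inl q.1.2)) (e (inl q.2)) in
  polyfun (vars [::]) D /\ exists e, D e != 0.
Proof.
elim: qs => [|[[k k1] k2] qs IH] td D.
  split; first by apply: (@PfConst _ _ _ 1) => e; rewrite /D big_nil.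
  by exists (fun=> 0); rewrite /D big_nil oner_eq0.
have /= /and4P[kk1 kk2 _ /IH [H1 [e1 H2]]] := td.
pose d (e : env) := apexDisc (e (inl k)) (e (inl k1)) (e (inl k2)).
have pd : polyfun (vars [::]) d.
  have pv k' : polyfun (vars [::]) (fun e : env => e (inl k')) by apply: pf_var.
  by rewrite /d /apexDisc; repeat (exact || apply: pf_exp || apply: pf_sub || apply: pf_mul || apply: pf_add || apply: pf_const).
(* At [y = 1] and [y1 = y2 = -1] the discriminant equals 16. *)
have [|e He] := @pf_mul_neq0 _ _ _ _ _ (upd (fun=> -1) (inl k) 1) e1 char0 pd H1 _ H2.
  rewrite /d upd_same !upd_other; last 2 first.
  - by apply: contraNneq kk2 => -[->].
  - by apply: contraNneq kk1 => -[->].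
  rewrite /apexDisc (_ : _ - _ = 16%:R); first exact: char0 15.
  by ring.
split; first by apply: (PfMul pd H1) => e'; rewrite /D big_cons.
by exists e; rewrite /D big_cons.
Qed.

Lemma choose_roots (y : K -> F) (qs : seq (K * K * K)) :
  uniq (keys qs) -> (forall q, q \in qs -> apexDisc (y q.1.1) (y q.1.2) (y q.2) != 0) ->
  (forall k, y k != 1) ->
  exists r0 r1 : K -> F, forall q, q \in qs -> r0 q.1.1 != r1 q.1.1 /\
    forall x, apexQ (y q.1.1) (y q.1.2) (y q.2) x = 0 <-> x = r0 q.1.1 \/ x = r1 q.1.1.
Proof.
elim: qs => [|[[k k1] k2] qs IH] /=; first by exists (fun=> 0), (fun=> 0).
move=> /andP[/mapP kqs U] D y1.
have [q qs'|//|r0 [r1 H]] := IH U; first by apply: D; rewrite in_cons qs' orbT.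
have [x0 [x1 [x01 Hx]]] := apexQ_roots char0 sqrtF (y1 k2) (D (k, k1, k2) (mem_head _ _)).
exists (upd r0 k x0), (upd r1 k x1) => q; rewrite in_cons => /orP[/eqP->|qs'].
  by rewrite !upd_same.
by rewrite !upd_other; [exact: H|..]; apply/eqP => qk; apply: kqs; exists q.
Qed.

(** A subset [A] of the keys tells at which interior triangles the second root is taken. The single
    generic configuration [p0], with its own cross-ratios [y0], ensures that the open condition is
    not empty. Since [g] depends on cross-ratios only, the second argument of [env_of y y] is a
    placeholder. *)
Theorem generic_count (l r : tree) (x : E) (p0 : E -> vec) (y0 : K -> F) :
  let qs := inner l ++ inner r in
  let I0 := [set k in keys qs] in
  uniq (x :: leaves l ++ leaves r) -> (forall f, f \in x :: leaves l ++ leaves r) ->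
  topdown qs ->
  generic_conf p0 -> (forall k, y0 k != 0 /\ y0 k != 1) -> rsat y0 p0 l r x ->
  exists (g : env -> F) e1, [/\ polyfun (vars [::]) g, g e1 != 0 &
    forall y : K -> F, (forall k, y k != 0 /\ y k != 1) ->
    g (env_of y y) != 0 ->
    exists P : {set K} -> E -> vec,
      [/\ forall A : {set K}, A \subset I0 -> generic_conf (P A) /\ rsat y (P A) l r x,
          forall A B : {set K}, A \subset I0 -> B \subset I0 -> sim (P A) (P B) -> A = B &
          forall p, generic_conf p -> rsat y p l r x -> exists2 A : {set K}, A \subset I0 & sim (P A) p]].
Proof.
move=> qs I0 U full td G0 y01 S0.
(* [H] is nonzero exactly when the constructed points are pairwise distinct. *)
pose H (e : env) := \prod_(f : E) \prod_(g | f != g)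
  br (rconf (e \o inl) (e \o inr) l r x f) (rconf (e \o inl) (e \o inr) l r x g).
have H_generic y nu : H (env_of y nu) != 0 -> generic_conf (rconf y nu l r x).
  move/prodf_neq0 => H0 f g fg; have := H0 f isT => /prodf_neq0 /(_ g fg).
  by [].
have H_neq0 y nu : generic_conf (rconf y nu l r x) -> H (env_of y nu) != 0.
  by move=> G; apply/prodf_neq0 => f _; apply/prodf_neq0 => g fg; apply: G.
have PH : polyfun (vars (keys qs)) H.
  apply: pf_prod => f; apply: pf_prod => g.
  by apply: pf_br; apply: pvec_rconf => // q qin; apply: map_f.
have Uq := topdown_uniq td.
move: (U); rewrite /= mem_cat negb_or cat_uniq => /andP[/andP[el er] /and3P[Ul /hasPn dj Ur]].
have Ml := rightmost_leaves l; have mr := leftmost_leaves r.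
have er' : leftmost r \notin leaves l by apply: dj.
have lr' : rightmost l \notin leaves r by apply/negP => /dj /negP; apply.
have e_t : x != leftmost r by apply: contraNneq er => ->.
have s_e : rightmost l != x by apply: contraNneq el => <-.
have [Ukl Ukr] : uniq (keys (inner l)) /\ uniq (keys (inner r)).
  by move: Uq; rewrite /keys map_cat cat_uniq => /and3P[].
have get_nu (p : E -> vec) : generic_conf p -> exists nu, rapexes nu p l r x.
  move=> G; have [nl Hl] := apexes_exists G Ukl Ul el er' e_t.
  have [nr Hr] := apexes_exists G Ukr Ur lr' er s_e.
  exists (fun k => if k \in keys (inner l) then nl k else nr k); split.
    by apply: apexes_local Hl => k ->.
  apply: apexes_local Hr => k kr; rewrite ifF //.
  by move: Uq; rewrite /keys map_cat cat_uniq => /and3P[_ /hasPn Hh _]; apply/negbTE/Hh.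
have solves_cat y nu : (forall q, q \in qs -> eqnQ (env_of y nu) q = 0) <->
    solves y nu l /\ solves y nu r.
  split=> [Q|[Sl Sr] q].
    by split=> q qin; apply: Q; rewrite mem_cat qin ?orbT.
  by rewrite mem_cat => /orP[/Sl|/Sr].
have [nu0 A0] := get_nu _ G0.
have [Sl0 Sr0 sim0] := rconf_sim G0 U full S0 A0.
have generic_sim (p q : E -> vec) : sim p q -> generic_conf q -> generic_conf p.
  by move=> [z [c [z0 c0 E']]] G f g fg; rewrite E' !mulf_neq0 //; apply: G.
(* The reconstruction of [p0] from [y0] and [nu0] is similar to [p0], so it solves the quadratics
   and has [H] nonzero. *)
have [] := @eliminate _ _ char0 sqrtF qs H (env_of y0 nu0) td PH.
- exact: y01.
- by apply/solves_cat.
- exact/H_neq0/(generic_sim _ _ sim0).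
move=> g1 [e1 [Pg1 g10 Hg1]].
have [PD [e2 D0]] := disc_prod td; set D := (fun e => _) in PD D0.
have [e3 He3] := pf_mul_neq0 char0 Pg1 PD g10 D0.
exists (fun e => g1 e * D e), e3; split=> //; first exact: pf_mul.
move=> y Y; rewrite mulf_eq0 negb_or => /andP[gy Dy].
have [||r0 [r1 Hr]] := @choose_roots y qs Uq.
- by move=> q qin; have := Dy; rewrite /D (big_rem q) //= mulf_eq0 negb_or => /andP[].
- by move=> k; have [] := Y k.
(* Nonzero discriminants make [r0] and [r1] differ at every key, so distinct [A] inside [I0] give
   distinct parameters. *)
pose nu (A : {set K}) k := if k \in A then r1 k else r0 k.
have Snu A : solves y (nu A) l /\ solves y (nu A) r.
  apply/solves_cat => q qin; have [_ Hq] := Hr q qin; apply/Hq.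
  by rewrite /nu /=; case: ifP; [right|left].
have Gnu A : generic_conf (rconf y (nu A) l r x).
  apply: H_generic; apply: contraNneq gy => H0.
  have := Hg1 (env_of y (nu A)) Y; rewrite H0 => /(_ _ erefl) <-.
    by apply/eqP/(pf_local Pg1) => -[k|k].
  exact/solves_cat.
have sat_nu A : rsat y (rconf y (nu A) l r x) l r x /\ rapexes (nu A) (rconf y (nu A) l r x) l r x.
  by have [? ?] := Snu A; apply: rconf_sat.
have inQ k : k \in I0 -> exists2 q, q \in qs & k = q.1.1 by rewrite inE => /mapP.
have keysP k : k \in I0 -> k \in keys (inner l) \/ k \in keys (inner r).
  by rewrite inE /keys map_cat mem_cat => /orP.
have nu_eq (p : E -> vec) nu1 nu2 : generic_conf p -> rapexes nu1 p l r x -> rapexes nu2 p l r x ->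
    forall k, k \in I0 -> nu1 k = nu2 k.
  move=> G [a1 b1] [a2 b2] k /keysP[kl|kr].
  - exact: (apexes_unique G Ul el er' e_t a1 a2).
  - exact: (apexes_unique G Ur lr' er s_e b1 b2).
exists (fun A => rconf y (nu A) l r x); split.
- by move=> A _; have [] := sat_nu A.
- move=> A B AI BI AB; apply/setP => k.
  case kI: (k \in I0); last first.
    by apply/idP/idP => h; move: kI; [rewrite (subsetP AI _ h)|rewrite (subsetP BI _ h)].
  have : nu A k = nu B k.
    apply: (nu_eq _ _ _ (Gnu A)) kI; first by have [] := sat_nu A.
    by have [_ [? ?]] := sat_nu B; split; apply: (sim_apexes AB).
  have [q qin kE] := inQ _ kI; have [r01 _] := Hr q qin.
  rewrite /nu kE; case: ifP => _; case: ifP => _ // E'; last by rewrite E' eqxx in r01.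
  by rewrite E' eqxx in r01.
- move=> p G S; have [mu Hmu] := get_nu p G.
  have [Sl Sr sp] := rconf_sim G U full S Hmu.
  (* The parameters [mu] of [p] satisfy the quadratics, hence each is one of the two roots; [A]
     records which. *)
  pose A := [set k in I0 | mu k == r1 k].
  exists A; first by apply/subsetP => k; rewrite inE => /andP[].
  have muA k : k \in I0 -> nu A k = mu k.
    move=> kI; rewrite /nu inE kI /=; case: eqP => [->//|r1k].
    have [q qin kE] := inQ _ kI; have [_ Hq] := Hr q qin.
    have /Hq : apexQ (y q.1.1) (y q.1.2) (y q.2) (mu q.1.1) = 0.
      by move: qin; rewrite mem_cat => /orP[/Sl|/Sr].
    by rewrite -kE => -[].
  have HA : rapexes (nu A) p l r x.
    have [a1 a2] := Hmu; split; [apply: apexes_local a1|apply: apexes_local a2];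
      by move=> k kk; rewrite muA // inE /keys map_cat mem_cat kk ?orbT.
  by have [] := rconf_sim G U full S HA.
Qed.

End Count.

(** * The dual tree of a triangulation *)

Section Triangulations.
Local Open Scope nat_scope.
Variables (n : nat) (K : finType) (lab : K -> {set 'I_n}).
Hypothesis lab_inj : injective lab.
Notation tree := (tree 'I_n K).

Definition side (u v : nat) : {set 'I_n} := [set i : 'I_n | (i == u :> nat) || (i == v :> nat)].

Lemma side_inj a b a' b' : a < b < n -> a' < b' < n -> side a b = side a' b' -> a = a' /\ b = b'.
Proof.
move=> /andP[ab bn] /andP[ab' bn'] E.
have an : a < n by lia.
have an' : a' < n by lia.
have /setP H := E; have := H (Ordinal an); have := H (Ordinal bn).
have := H (Ordinal an'); have := H (Ordinal bn'); rewrite !inE /=.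
lia.
Qed.

(** The polygon cut off has vertices [u, ..., v] and leaf edges [u, ..., v - 1], edge [e] joining
    vertices [e] and [e + 1]. The edge [n - 1], the only one that wraps around, is kept for the
    root. *)
Fixpoint spans (t : tree) (u v : nat) : Prop :=
  match t with
  | Leaf e => e = u :> nat /\ v = u.+1
  | Node k l r => lab k = side u v /\ exists w, spans l u w /\ spans r w v
  end.

Lemma spans_lt t u v : spans t u v -> u < v.
Proof.
elim: t u v => [e|k l IHl r IHr] u v /=; first by case=> _ ->.
by case=> _ [w [/IHl ? /IHr ?]]; lia.
Qed.

Lemma spans_leaves t u v : spans t u v -> [seq val e | e <- leaves t] = iota u (v - u).
Proof.
elim: t u v => [e|k l IHl r IHr] u v /=; first by case=> -> ->; rewrite subSnn.
case=> _ [w [sl sr]]; rewrite map_cat (IHl _ _ sl) (IHr _ _ sr).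
have := spans_lt sl; have := spans_lt sr => wv uw.
have -> : v - u = (w - u) + (v - w) by lia.
by rewrite iotaD subnKC // ltnW.
Qed.

Lemma spans_ends t u v : spans t u v -> leftmost t = u :> nat /\ rightmost t = v.-1 :> nat.
Proof.
elim: t u v => [e|k l IHl r IHr] u v /=; first by case=> -> ->.
by case=> _ [w [/IHl [-> _] /IHr [_ ->]]].
Qed.

Lemma spans_labels t u v k : spans t u v -> k \in labels t ->
  exists a b, [/\ u <= a, a.+1 < b, b <= v & lab k = side a b].
Proof.
elim: t u v => [e|k0 l IHl r IHr] u v //= [lk [w [sl sr]]].
have := spans_lt sl; have := spans_lt sr => wv uw.
rewrite inE mem_cat => /orP[/eqP->|/orP[/(IHl _ _ sl)|/(IHr _ _ sr)]].
- by exists u, v; split=> //; lia.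
- by move=> [a [b [? ? ? ?]]]; exists a, b; split=> //; lia.
- by move=> [a [b [? ? ? ?]]]; exists a, b; split=> //; lia.
Qed.

Lemma spans_split l r u w v k a b : spans l u w -> spans r w v -> v < n ->
  k \in labels l ++ labels r -> a < b < n -> lab k = side a b ->
  (k \in labels l /\ b <= w) \/ (k \in labels r /\ w <= a).
Proof.
move=> sl sr vn + ab lk; have := spans_lt sl; have := spans_lt sr => wv uw.
rewrite mem_cat => /orP[kl|kr].
- have [a' [b' [? ? ? E]]] := spans_labels sl kl.
  by left; split=> //; have [|] := side_inj ab _ (etrans (esym lk) E); lia.
- have [a' [b' [? ? ? E]]] := spans_labels sr kr.
  by right; split=> //; have [|] := side_inj ab _ (etrans (esym lk) E); lia.
Qed.

Lemma spans_uniq_cat l r u w v : spans l u w -> spans r w v -> v < n ->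
  uniq (labels l) -> uniq (labels r) -> uniq (labels l ++ labels r).
Proof.
move=> sl sr vn Ul Ur; rewrite cat_uniq Ul Ur andbT /=; apply/hasPn => k kr; apply/negP => kl.
have [a [b [? ? ? E]]] := spans_labels sl kl; have [a' [b' [? ? ? E']]] := spans_labels sr kr.
have := spans_lt sl; have := spans_lt sr => wv uw.
by have [||] := side_inj _ _ (etrans (esym E) E'); lia.
Qed.

Lemma spans_uniq t u v : spans t u v -> v < n -> uniq (labels t).
Proof.
elim: t u v => [e|k l IHl r IHr] u v //= [lk [w [sl sr]]] vn.
have := spans_lt sl; have := spans_lt sr => wv uw.
rewrite (spans_uniq_cat sl sr vn) ?(IHl _ _ sl) ?(IHr _ _ sr) //; last by lia.
rewrite andbT; apply/negP => kk.
have uvn : u < v < n by lia.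
by have [] := spans_split sl sr vn kk uvn lk; lia.
Qed.

Lemma inner_labels (t : tree) q : q \in inner t ->
  [/\ q.1.1 \in labels t, q.1.2 \in labels t & q.2 \in labels t].
Proof.
elim: t => [e|k l IHl r IHr] //=; rewrite !mem_cat => /orP[|/orP[/IHl|/IHr] []].
- case: (l) (r) => [?|k1 l1 r1] [?|k2 l2 r2] //; rewrite mem_seq1 => /eqP-> /=.
  by rewrite !inE !mem_cat !inE !eqxx !orbT.
- by move=> *; split; rewrite inE mem_cat; apply/orP; right; apply/orP; left.
- by move=> *; split; rewrite inE mem_cat; apply/orP; right; apply/orP; right.
Qed.

Lemma topdown_cat (s1 s2 : seq (K * K * K)) : topdown s1 -> topdown s2 ->
  (forall q q', q \in s1 -> q' \in s2 -> [/\ q.1.1 != q'.1.1, q.1.1 != q'.1.2 & q.1.1 != q'.2]) ->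
  topdown (s1 ++ s2).
Proof.
elim: s1 => [//|q s1 IH] /= /and4P[q1 q2 qa td1] td2 H.
rewrite q1 q2 all_cat qa IH //=; last by move=> q0 q' q01; apply: H; rewrite in_cons q01 orbT.
rewrite andbT; apply/allP => q' q's.
by have [-> -> ->] := H q q' (mem_head _ _) q's.
Qed.

Lemma topdown_inner_cat (l r : tree) : uniq (labels l ++ labels r) ->
  topdown (inner l) -> topdown (inner r) -> topdown (inner l ++ inner r).
Proof.
rewrite cat_uniq => /and3P[_ /hasPn dj _] tl tr; apply: topdown_cat => // q q'.
move=> /inner_labels [k _ _] /inner_labels [a b c].
by split; [move: a|move: b|move: c] => /dj; apply: contraNneq => <-.
Qed.

Lemma topdown_inner (t : tree) : uniq (labels t) -> topdown (inner t).
Proof.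
elim: t => [e|k l IHl r IHr] //= /andP[kk U].
move: (U); rewrite cat_uniq => /and3P[Ul _ Ur].
have tlr := topdown_inner_cat U (IHl Ul) (IHr Ur).
have nk k' : k' \in labels l ++ labels r -> k != k' by apply: contraTneq => <-.
apply: topdown_cat => //.
  move: nk; case: (l) (r) => [?|k1 l1 r1] [?|k2 l2 r2] //= nk.
  by rewrite !nk // !(inE, mem_cat) eqxx ?orbT.
move=> q q' qk; have -> : q.1.1 = k.
  by move: qk; case: (l) (r) => [?|k1 l1 r1] [?|k2 l2 r2] //=; rewrite mem_seq1 => /eqP->.
rewrite mem_cat => /orP[] /inner_labels [a b c]; split; apply: nk; rewrite mem_cat ?a ?b ?c ?orbT //.
Qed.

Lemma inner_spec (t : tree) u v q : spans t u v -> q \in inner t ->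
  exists a b c, [/\ u <= a, a < b < c, c <= v, lab q.1.1 = side a c &
                 lab q.1.2 = side a b /\ lab q.2 = side b c].
Proof.
elim: t u v => [e|k l IHl r IHr] u v //= [lk [w [sl sr]]].
have := spans_lt sl; have := spans_lt sr => wv uw.
rewrite !mem_cat => /orP[|/orP[/(IHl _ _ sl)|/(IHr _ _ sr)]]; last 2 first.
- by move=> [a [b [c [? ? ? ? ?]]]]; exists a, b, c; split=> //; lia.
- by move=> [a [b [c [? ? ? ? ?]]]]; exists a, b, c; split=> //; lia.
move: sl sr; case: (l) (r) => [?|k1 l1 r1] [?|k2 l2 r2] //= [l1E _] [l2E _].
by rewrite mem_seq1 => /eqP->; exists u, w, v; split=> //; lia.
Qed.

Lemma inner_cat_complete (l r : tree) u w v a b c kab kbc kac :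
  spans l u w -> spans r w v -> v < n -> a < b < c -> c < n ->
  kab \in labels l ++ labels r -> lab kab = side a b ->
  kbc \in labels l ++ labels r -> lab kbc = side b c ->
  kac \in labels l ++ labels r -> lab kac = side a c ->
  [/\ kab \in labels l, kbc \in labels l & kac \in labels l] \/
  [/\ kab \in labels r, kbc \in labels r & kac \in labels r].
Proof.
move=> sl sr vn abc cn iab eab ibc ebc iac eac.
have [hab hbc hac] : [/\ a < b < n, b < c < n & a < c < n] by split; lia.
case: (spans_split sl sr vn iab hab eab) (spans_split sl sr vn ibc hbc ebc)
  (spans_split sl sr vn iac hac eac) => -[? ?] [] [? ?] [] [? ?]; try lia; by [left|right].
Qed.

(** If the long side is not the top side, all three sides lie in one subtree. Otherwise no label
    straddles the apex [w] except the top one, so the short sides lie in different subtrees and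
    [b = w]. *)
Lemma inner_complete (t : tree) u v a b c kab kbc kac :
  spans t u v -> v < n -> a < b < c -> c < n ->
  kab \in labels t -> lab kab = side a b ->
  kbc \in labels t -> lab kbc = side b c ->
  kac \in labels t -> lab kac = side a c -> (kac, kab, kbc) \in inner t.
Proof.
elim: t u v => [e|k l IHl r IHr] u v //= [lk [w [sl sr]]] vn abc cn iab eab ibc ebc iac eac.
have := spans_lt sl; have := spans_lt sr => wv uw.
have nk k' x z : lab k' = side x z -> x < z < n -> (x, z) != (u, v) ->
    k' \in k :: labels l ++ labels r -> k' \in labels l ++ labels r.
  move=> E xz; rewrite inE => /negP ne /orP[/eqP kk|//]; case: ne.
  have uv : u < v < n by lia.
  rewrite kk lk in E; have [-> ->] := side_inj uv xz E; exact: eqxx.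
have [hab hbc hac] : [/\ a < b < n, b < c < n & a < c < n] by split; lia.
rewrite !mem_cat; case: (eqVneq (a, c) (u, v)) => [[au cv]|acuv]; last first.
  have bounds : u <= a /\ c <= v.
    have := nk _ _ _ eac hac acuv iac; move=> kin.
    have := spans_split sl sr vn kin hac eac; rewrite mem_cat in kin.
    case/orP: kin => [kl|kr] _.
      have [a' [b' [? ? ? E]]] := spans_labels sl kl.
      by have [|] := side_inj hac _ (etrans (esym eac) E); lia.
    have [a' [b' [? ? ? E]]] := spans_labels sr kr.
    by have [|] := side_inj hac _ (etrans (esym eac) E); lia.
  have abuv : (a, b) != (u, v) by apply/eqP => -[]; lia.
  have bcuv : (b, c) != (u, v) by apply/eqP => -[]; lia.
  have wn : w < n by lia.
  case: (inner_cat_complete sl sr vn abc cn (nk _ _ _ eab hab abuv iab) eab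
    (nk _ _ _ ebc hbc bcuv ibc) ebc (nk _ _ _ eac hac acuv iac) eac) => -[? ? ?].
  - by rewrite (IHl _ _ sl wn) ?orbT.
  - by rewrite (IHr _ _ sr vn) ?orbT.
have kacE : kac = k by apply: lab_inj; rewrite eac lk au cv.
have abuv : (a, b) != (u, v) by apply/eqP => -[]; lia.
have bcuv : (b, c) != (u, v) by apply/eqP => -[]; lia.
have [[abl bw]|[_ ?]] := spans_split sl sr vn (nk _ _ _ eab hab abuv iab) hab eab; last by lia.
have [[_ ?]|[bcr wb]] := spans_split sl sr vn (nk _ _ _ ebc hbc bcuv ibc) hbc ebc; first by lia.
have bE : b = w by lia.
apply/orP; left; move: sl sr abl bcr; case: (l) (r) => [?|k1 l1 r1] [?|k2 l2 r2] // [e1 _] [e2 _] _ _.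
by rewrite mem_seq1 kacE; apply/eqP; congr (_, _, _); apply: lab_inj;
  rewrite ?eab ?ebc ?e1 ?e2 ?au ?bE ?cv.
Qed.

(** * Construction of the dual tree and its interior triangles *)

Section FromTriangulation.
Variable T : {set {set 'I_n}}.
Hypothesis n4 : 4 <= n.
Hypothesis triT : triangulation T.
Hypothesis labT : forall D, (D \in T) <-> exists k, lab k = D.

Lemma triangulation_side D : D \in T ->
  exists a b, [/\ a.+1 < b, b < n, (a, b) != (0, n.-1) & D = side a b].
Proof.
move=> DT; have [Hd _ _] := triT; have /andP[/cards2P [x [z [xz DE]]] /forall_inP H] := Hd _ DT.
wlog lt_xz : x z xz DE / x < z => [W|].
  case: (ltngtP x z) => h; [exact: (W x z)| |by case/eqP: xz; apply: val_inj].
  by apply: (W z x) => //; rewrite 1?eq_sym // DE setUC.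
have xD : x \in D by rewrite DE !inE eqxx.
have zD : z \in D by rewrite DE !inE eqxx orbT.
have /forall_inP H1 := H x xD; have /implyP /(_ xz) := H1 z zD; rewrite /adjacent negb_or.
move=> /andP[/eqP h1 /eqP h2].
have zn := ltn_ord z; exists x, z; split=> //.
- rewrite ltn_neqAle lt_xz andbT; apply/eqP => e; apply: h1; apply: val_inj => /=.
  by rewrite -e modn_small // e.
- apply/eqP => -[x0 zE]; apply: h2; apply: val_inj => /=.
  by rewrite zE prednK ?modnn //; lia.
- by rewrite DE; apply/setP => i; rewrite !inE !(inj_eq val_inj).
Qed.

Lemma triangulation_noncrossing a b c d :
  side a c \in T -> side b d \in T -> a < b -> b < c -> c < d -> d < n -> False.
Proof.
move=> acT bdT ab bc cd dn; have [_ _ /(_ _ _ acT bdT) /negP] := triT; apply.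
have [an [bn cn]] : a < n /\ b < n /\ c < n by lia.
apply/existsP; exists (Ordinal an); rewrite inE eqxx /=.
apply/existsP; exists (Ordinal cn); rewrite inE eqxx orbT /=.
apply/existsP; exists (Ordinal bn); rewrite inE eqxx /=.
apply/existsP; exists (Ordinal dn); rewrite inE eqxx orbT /=.
by rewrite ab bc cd.
Qed.

Definition inside (u v : nat) : {set {set 'I_n}} :=
  [set D in T | [forall i in D, u <= i <= v]].

Lemma insideP u v D : D \in inside u v <-> exists a b,
  [/\ u <= a, a.+1 < b, b <= v, b < n & D = side a b /\ D \in T].
Proof.
rewrite inE; split=> [/andP[DT /forall_inP H]|[a [b [ua ab bv bn [-> ->]]]]]; last first.
  by apply/forall_inP => i; rewrite inE => /orP[]/eqP->; lia.
have [a [b [ab bn _ DE]]] := triangulation_side DT.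
have an : a < n by lia.
have := H (Ordinal an); have := H (Ordinal bn); rewrite DE !inE /= !eqxx orbT.
move=> /(_ isT) ? /(_ isT) ?; exists a, b; split; by [lia|split; rewrite -?DE].
Qed.

(* The apex of the triangle of [T] lying below the side [u v]. *)
Lemma inside_split u v : u.+1 < v -> v < n ->
  exists w, u < w < v /\ inside u v \subset side u v |: (inside u w :|: inside w v).
Proof.
(* The apex is the largest [w] joined to [u], the edge to [u + 1] included. A diagonal straddling
   [w] either starts inside and crosses [u w], or starts at [u] and contradicts maximality unless it
   is [u v]. *)
move=> uv vn; pose P w := (u < w < v) && ((side u w \in T) || (w == u.+1)).
have exP : exists w, P w by exists u.+1; rewrite /P eqxx orbT; lia.
have bdP w : P w -> w <= v by move=> /andP[]; lia.
case: (ex_maxnP exP bdP) => w /andP[uwv wT] wmax; exists w; split=> //.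
apply/subsetP => D /insideP [a [b [ua ab bv bn [DE DT]]]].
rewrite in_setU1 in_setU.
have [bw|wb] := leqP b w.
  by apply/orP; right; apply/orP; left; apply/insideP; exists a, b; split=> //.
have [wa|aw] := leqP w a.
  by apply/orP; right; apply/orP; right; apply/insideP; exists a, b; split=> //.
case: (eqVneq a u) => [au|neq]; last first.
  case/orP: wT => [wT|/eqP]; last by lia.
  by case: (triangulation_noncrossing (a := u) (b := a) (c := w) (d := b)) => //; rewrite -?DE //; lia.
case: (eqVneq b v) => [bvE|bneq]; first by rewrite DE au bvE eqxx.
have /wmax : P b by rewrite /P -au -DE DT andbT; lia.
lia.
Qed.

Lemma inside_edge u : inside u u.+1 = set0.
Proof.
apply/setP => D; rewrite in_set0; apply/negP => /insideP [a [b [? ? ? ? _]]]; lia.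
Qed.

Lemma insideS u v u' v' : u <= u' -> v' <= v -> inside u' v' \subset inside u v.
Proof.
move=> uu vv; apply/subsetP => D /insideP [a [b [? ? ? ? ?]]].
by apply/insideP; exists a, b; split=> //; lia.
Qed.

(** The split at the apex gives at most [(w - u - 1) + (v - w - 1)] diagonals, plus the side [u v]
    itself. *)
Lemma card_inside u v : u < v -> v < n -> #|inside u v| <= (v - u).-1.
Proof.
move: {2}(v - u) (leqnn (v - u)) => m; elim: m u v => [|m IH] u v; first by lia.
move=> vum uv vn; have [uv2|vu] := ltnP u.+1 v; last first.
  by have -> : v = u.+1 by [lia]; rewrite inside_edge cards0.
have [w [/andP[uw wv] /subset_leq_card]] := inside_split uv2 vn.
rewrite cardsU1; have [+ _] := leq_card_setU (inside u w) (inside w v).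
have := IH u w ltac:(lia) uw ltac:(lia); have := IH w v ltac:(lia) wv vn.
by case: (_ \notin _) => /=; lia.
Qed.

(** Equality in the bound of [card_inside] forces equality in both parts and the presence of [u v],
    so the recursion can continue on each side of the apex. *)
Lemma spans_exists u v : u < v -> v < n -> #|inside u v| = (v - u).-1 ->
  exists t, spans t u v /\ forall k, k \in labels t <-> lab k \in inside u v.
Proof.
move: {2}(v - u) (leqnn (v - u)) => m; elim: m u v => [|m IH] u v; first by lia.
move=> vum uv vn; have [uv2|vu] := ltnP u.+1 v; last first.
  have vE : v = u.+1 by lia.
  rewrite vE inside_edge => _; exists (Leaf (Ordinal (ltn_trans uv vn))); split=> // k.
  by rewrite inE.
move=> cE; have [w [/andP[uw wv] sub]] := inside_split uv2 vn.
have := subset_leq_card sub; rewrite cardsU1 cE.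
have [+ _] := leq_card_setU (inside u w) (inside w v).
have wn : w < n by lia.
have := card_inside uw wn; have := card_inside wv vn => c1 c2 c3.
have c5 : #|inside u w :|: inside w v| <= (v - u).-2.
  by apply: leq_trans c3 (leq_trans (leq_add c2 c1) _); lia.
case: (_ \notin _) => c4; last by exfalso; move: c4 c5; lia.
have full x y z a b : z <= x + y -> x <= a -> y <= b -> a + b < true + z -> x = a /\ y = b by lia.
have [|cuw cwv] := full _ _ _ _ _ c3 c2 c1; first by apply: leq_trans c4; lia.
have [|l [sl Hl]] := IH u w _ uw wn cuw; first by lia.
have [|r [sr Hr]] := IH w v _ wv vn cwv; first by lia.
have uvT : side u v \in inside u v.
  apply: contraT => nuv; have : inside u v \subset inside u w :|: inside w v.
    apply/subsetP => D Din; have := subsetP sub D Din; rewrite in_setU1 => /orP[/eqP DE|//].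
    by rewrite DE (negPf nuv) in Din.
  by move/subset_leq_card; rewrite cE => c6; have := leq_trans c6 c5; lia.
have [k kE] : exists k, lab k = side u v by apply/labT; move: uvT; rewrite inE => /andP[].
exists (Node k l r); split; first by split=> //; exists w.
move=> k'; rewrite /= inE mem_cat; split=> [/orP[/eqP->|/orP[/Hl|/Hr]]|].
- by rewrite kE.
- by apply/subsetP/insideS => //; apply: ltnW.
- by apply/subsetP/insideS => //; apply: ltnW.
move/(subsetP sub); rewrite in_setU1 in_setU -kE (inj_eq lab_inj).
by case/orP=> [->//|/orP[/Hl->|/Hr->]]; rewrite !orbT.
Qed.

(** The pair [0, n - 1] bounds a polygon edge and is not in [T]. The [n - 3] diagonals thus all fall
    into the two parts below the root triangle, whose bounds add up to exactly [n - 3]. *)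
Lemma spans_root : exists l r w, [/\ spans l 0 w, spans r w n.-1 & forall k, k \in labels l ++ labels r].
Proof.
have TE D : D \in T -> D \in inside 0 n.-1.
  move=> DT; have [a [b [ab bn _ DE]]] := triangulation_side DT.
  by apply/insideP; exists a, b; split=> //; lia.
have rootN : side 0 n.-1 \notin T.
  apply/negP => /triangulation_side [a [b [ab bn + /side_inj E]]].
  by have [||<- <-] := E; rewrite ?eqxx //; lia.
have cT : #|inside 0 n.-1| = n - 3.
  have [_ <- _] := triT; apply: eq_card => D; apply/idP/idP; last exact: TE.
  by rewrite inE => /andP[].
have nn : n.-1 < n by lia.
have [|w [/andP[w0 wn] sub]] := inside_split (u := 0) _ nn; first by lia.
have sub' : inside 0 n.-1 \subset inside 0 w :|: inside w n.-1.
  apply/subsetP => D Dn; have := subsetP sub D Dn; rewrite in_setU1 => /orP[/eqP DE|//].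
  by move: Dn rootN; rewrite DE inE => /andP[->].
have := subset_leq_card sub'; rewrite cT; have [+ _] := leq_card_setU (inside 0 w) (inside w n.-1).
have wn' : w < n by lia.
have := card_inside w0 wn'; have := card_inside wn nn => c1 c2 c3 c4.
have full x y z a b : z <= x + y -> x <= a -> y <= b -> a + b <= z -> x = a /\ y = b by lia.
have [|cl cr] := full _ _ _ _ _ (leq_trans c4 c3) c2 c1; first by lia.
have [l [sl Hl]] := spans_exists w0 wn' cl.
have [r [sr Hr]] := spans_exists wn nn cr.
exists l, r, w; split=> // k; rewrite mem_cat.
have /TE/(subsetP sub') : lab k \in T by apply/labT; exists k.
by rewrite in_setU => /orP[/Hl->|/Hr->]; rewrite ?orbT.
Qed.

Lemma sorted_enum_ord (S : {set 'I_n}) : sorted ltn [seq val i | i <- enum S].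
Proof.
have -> : enum S = [seq i <- enum 'I_n | i \in S] by rewrite enumT.
rewrite sorted_map; apply: sorted_filter => [x y z|]; first exact: ltn_trans.
by rewrite -sorted_map val_enum_ord iota_ltn_sorted.
Qed.

(** A triple of labels is sent to the vertex set of its triangle, the union of the two lower sides.
    The increasing vertices can be read off from this set, which gives injectivity; [inner_complete]
    gives surjectivity. *)
Lemma interior_triangles_inner l r w :
  spans l 0 w -> spans r w n.-1 -> (forall k, k \in labels l ++ labels r) ->
  interior_triangles T = size (inner l ++ inner r).
Proof.
move=> sl sr full; pose f (q : K * K * K) := lab q.1.2 :|: lab q.2.
have w0 := spans_lt sl; have wn := spans_lt sr; have nn : n.-1 < n by lia.
have wn' : w < n by lia.
set qs := inner l ++ inner r.
have spec q : q \in qs -> exists a b c, [/\ a < b < c, c < n, lab q.1.1 = side a c,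
    lab q.1.2 = side a b & lab q.2 = side b c].
  rewrite mem_cat => /orP[/(inner_spec sl)|/(inner_spec sr)] [a [b [c [? ? ? ? [? ?]]]]];
    by exists a, b, c; split=> //; lia.
have Uqs : uniq (keys qs).
  apply/topdown_uniq/topdown_inner_cat.
  - exact: spans_uniq_cat sl sr nn (spans_uniq sl wn') (spans_uniq sr nn).
  - exact/topdown_inner/(spans_uniq sl wn').
  - exact/topdown_inner/(spans_uniq sr nn).
have f_inj : {in qs &, injective f}.
  move=> q q' qin q'in; have [a [b [c [/andP[ab bc] cn e1 e2 e3]]]] := spec q qin.
  have [a' [b' [c' [/andP[ab' bc'] cn' e1' e2' e3']]]] := spec q' q'in.
  rewrite /f e2 e3 e2' e3' => /setP H.
  have [an [bn [an' bn']]] : a < n /\ b < n /\ a' < n /\ b' < n by lia.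
  have bd x y z i : x < y -> y < z -> (i == x) || (i == y) || ((i == y) || (i == z)) -> x <= i <= z /\ (x < i < z -> i = y) by lia.
  have Hin (i : 'I_n) : (i \in side a b :|: side b c) -> a' <= i <= c' /\ (a' < i < c' -> i = b' :> nat).
    by rewrite H !inE; apply: bd.
  have Hin' (i : 'I_n) : (i \in side a' b' :|: side b' c') -> a <= i <= c /\ (a < i < c -> i = b :> nat).
    by rewrite -H !inE; apply: bd.
  have [/= aa _] := Hin (Ordinal an) ltac:(by rewrite !inE /= eqxx).
  have [/= cc _] := Hin (Ordinal cn) ltac:(by rewrite !inE /= eqxx !orbT).
  have [/= bb bb'] := Hin (Ordinal bn) ltac:(by rewrite !inE /= eqxx !orbT).
  have [/= aa' _] := Hin' (Ordinal an') ltac:(by rewrite !inE /= eqxx).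
  have [/= cc' _] := Hin' (Ordinal cn') ltac:(by rewrite !inE /= eqxx !orbT).
  have aE : a = a' by lia.
  have cE : c = c' by lia.
  have bE : b = b' by apply: bb'; lia.
  move: e1 e2 e3; rewrite aE bE cE -e1' -e2' -e3' => /lab_inj k0 /lab_inj k1 /lab_inj k2.
  by case: (q) (q') k0 k1 k2 => [[? ?] ?] [[? ?] ?] /= -> -> ->.
rewrite -(size_map f) -(card_uniqP _); last by rewrite map_inj_in_uniq // (map_uniq Uqs).
apply: eq_card => X; rewrite inE; apply/idP/mapP => [/andP[/eqP cX /forall_inP H]|[q qin ->]].
  have := sorted_enum_ord X; have := mem_enum X; have : size (enum X) = 3 by rewrite -cardE.
  case: (enum X) => [|x [|y [|z [|? ?]]]] // _ memX /= /and3P[xy yz _].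
  have side_in (i j : 'I_n) : i \in X -> j \in X -> i < j -> exists k, lab k = side i j.
    move=> iX jX ij; apply/labT.
    have /forall_inP H1 := H i iX; have /implyP := H1 j jX.
    have -> : side i j = [set i; j] by apply/setP => s; rewrite !inE !(inj_eq val_inj).
    by apply; apply: contraTneq ij => ->; rewrite ltnn.
  have [xX yX zX] : [/\ x \in X, y \in X & z \in X] by rewrite -!memX !inE !eqxx !orbT.
  have [kxy exy] := side_in _ _ xX yX xy; have [kyz eyz] := side_in _ _ yX zX yz.
  have [kxz exz] := side_in _ _ xX zX (ltn_trans xy yz).
  exists (kxz, kxy, kyz).
    have xyz : x < y < z by rewrite xy yz.
    have zn := ltn_ord z.
    rewrite mem_cat; apply/orP.
    case: (inner_cat_complete sl sr nn xyz zn (full kxy) exy (full kyz) eyz (full kxz) exz) => -[? ? ?].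
    - by left; apply: (inner_complete sl wn' xyz zn).
    - by right; apply: (inner_complete sr nn xyz zn).
  rewrite /f /= exy eyz; apply/setP => s; rewrite -memX !inE !(inj_eq val_inj).
  by case: (s == x); case: (s == y); case: (s == z).
have [a [b [c [/andP[ab bc] cn e1 e2 e3]]]] := spec q qin.
have [an bn] : a < n /\ b < n by lia.
have XE : f q = [set Ordinal an; Ordinal bn; Ordinal cn].
  rewrite /f e2 e3; apply/setP => s; rewrite !inE -!(inj_eq val_inj) /=.
  by case: (_ == a); case: (_ == b); case: (_ == c).
have inT k : lab k \in T by apply/labT; exists k.
apply/andP; split.
  rewrite XE -setUA cardsU1 cards2 !inE -!(inj_eq val_inj) /=; lia.
have sideE (i j : 'I_n) : [set i; j] = side i j by apply/setP => s; rewrite !inE !(inj_eq val_inj).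
rewrite XE; apply/forall_inP => i iX; apply/forall_inP => j jX; apply/implyP => ij.
wlog lt_ij : i j iX jX ij / i < j => [W|].
  case: (ltngtP i j) => h; [exact: W| |by case/eqP: ij; apply: val_inj].
  by rewrite setUC; apply: W => //; rewrite eq_sym.
rewrite sideE; move: iX jX lt_ij; rewrite !inE -!(inj_eq val_inj) /=.
case/orP=> [/orP[]|] /eqP -> /orP[/orP[]|] /eqP ->; rewrite ?ltnn // => h; try lia.
- by rewrite -e2; apply: inT.
- by rewrite -e1; apply: inT.
- by rewrite -e3; apply: inT.
Qed.

End FromTriangulation.
End Triangulations.

(** * Cross-ratios of labelled points *)

Lemma CC_char0 (m : nat) : m.+1%:R != 0 :> CC.
Proof. exact: (negbT (@pnatr_eq0 (complex Rdefinitions.R : numClosedFieldType) m.+1)). Qed.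

Lemma CC_sqrt (a : CC) : exists b : CC, b ^+ 2 = a.
Proof.
pose C : numClosedFieldType := complex Rdefinitions.R.
by exists (sqrtC (a : C)); exact: (sqrtCK (a : C)).
Qed.

Definition pv (a : P1) : CC * CC := if a is Some z then (z, 1) else (1, 0).

Lemma br_pv a b : (br (pv a) (pv b) != 0) = (a != b).
Proof.
case: a b => [x|] [y|]; rewrite /br /= ?mulr1 ?mul1r ?mulr0 ?mul0r ?subr0 ?sub0r ?subrr.
- by rewrite subr_eq0; congr (~~ _); apply/eqP/eqP => [->//|[]].
- by rewrite oppr_eq0 oner_eq0.
- by rewrite oner_eq0.
- by rewrite !eqxx.
Qed.

(** At most one of the points is infinite. Its brackets are 1 or -1 instead of the conventional 1,
    with the same sign in numerator and denominator. *)
Lemma crossratio_br a b c d : uniq [:: a; b; c; d] ->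
  crossratio a b c d = (br (pv a) (pv c) * br (pv b) (pv d)) / (br (pv a) (pv d) * br (pv b) (pv c)).
Proof.
case: a b c d => [a|] [b|] [c|] [d|] U; try by move: U; rewrite /= !inE /= ?(eqxx, orbT, andbF).
all: rewrite /crossratio /br /=.
all: rewrite ?(mulr1, mul1r, mulr0, mul0r, subr0, sub0r, mulrN, mulNr, invrN, opprK) //.
Qed.

Section CrossRatios.
Variable n : nat.

Lemma enum_sorted_eq (S : {set 'I_n}) (s : seq 'I_n) :
  sorted ltn [seq val i | i <- s] -> s =i S -> enum S = s.
Proof.
move=> ss E; apply: (inj_map val_inj).
apply: (irr_sorted_eq ltn_trans ltnn (sorted_enum_ord S) ss) => x.
apply/mapP/mapP => -[i iS ->]; exists i => //; last by rewrite mem_enum -E.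
by rewrite E -mem_enum.
Qed.

Definition predn_mod (u : nat) := if u == 0%N then n.-1 else u.-1.

Lemma mem_S_of_side u v (x : 'I_n) : (u < n)%N -> (v < n)%N ->
  (x \in S_of (side n u v)) =
  [|| x == predn_mod u :> nat, x == u :> nat, x == predn_mod v :> nat | x == v :> nat].
Proof.
have predE (i : 'I_n) : ord_pred i = predn_mod i :> nat.
  rewrite /= /predn_mod; have := ltn_ord i; case: (nat_of_ord i) => [|m] mn /=.
    by rewrite add0n modn_small //; lia.
  by rewrite ?addSn /= -modnDmr modnn addn0 modn_small //; lia.
move=> un vn; apply/bigcupP/or4P => [H|].
  case: H => i; rewrite !inE => /orP[]/eqP iE /orP[]/eqP ->; rewrite ?predE iE eqxx;
    by [constructor 1|constructor 2|constructor 3|constructor 4].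
case=> /eqP E.
- exists (Ordinal un); rewrite !inE ?eqxx //; apply/orP; left; apply/eqP/ord_inj.
  by rewrite predE E.
- by exists (Ordinal un); rewrite !inE ?eqxx //; apply/orP; right; apply/eqP/val_inj.
- exists (Ordinal vn); rewrite !inE ?eqxx ?orbT //; apply/orP; left; apply/eqP/ord_inj.
  by rewrite predE E.
- by exists (Ordinal vn); rewrite !inE ?eqxx ?orbT //; apply/orP; right; apply/eqP/val_inj.
Qed.

(* For a diagonal with endpoint [0], the increasing enumeration of its four
   edges is a cyclic shift of [u - 1, u, v - 1, v], and the two cross-ratios
   are related by the involution [y / (y - 1)]. *)
Definition theta (D : {set 'I_n}) (y : CC) : CC :=
  if [exists i in D, i == 0%N :> nat] then y / (y - 1) else y.

Lemma theta_neq D y : y != 0 -> y != 1 -> theta D y != 0 /\ theta D y != 1.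
Proof.
move=> y0 y1; rewrite /theta; case: ifP => // _; have y10 : y - 1 != 0 by rewrite subr_eq0.
split; first by rewrite mulf_neq0 // invr_eq0.
apply/eqP => /(congr1 (fun z => z * (y - 1))); rewrite mulfVK // mul1r => /eqP.
by rewrite -subr_eq0 opprB addrC subrK oner_eq0.
Qed.

Lemma theta_inj D y z : y != 1 -> z != 1 -> theta D y = theta D z -> y = z.
Proof.
move=> y1 z1; rewrite /theta; case: ifP => // _ E.
have y10 : y - 1 != 0 by rewrite subr_eq0.
have z10 : z - 1 != 0 by rewrite subr_eq0.
have : y * (z - 1) = z * (y - 1).
  transitivity (y / (y - 1) * ((y - 1) * (z - 1))); first by field.
  by rewrite E; field.
rewrite !mulrBr !mulr1 [z * y]mulrC => /addrI /oppr_inj; exact.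
Qed.

Lemma cross_crS (p : 'I_n -> P1) (u v : nat) (a b c d : 'I_n) : injective p ->
  (u.+1 < v)%N -> (v < n)%N -> (u, v) != (0%N, n.-1) ->
  a = predn_mod u :> nat -> b = u :> nat -> c = v.-1 :> nat -> d = v :> nat ->
  let X := crS p (S_of (side n u v)) in
  [/\ X != 0, X != 1 & cross (pv (p a)) (pv (p b)) (pv (p c)) (pv (p d)) (theta (side n u v) X)].
Proof.
move=> p_inj uv vn nroot aE bE cE dE X.
have un : (u < n)%N by lia.
have G (i j : 'I_n) : i != j -> br (pv (p i)) (pv (p j)) != 0.
  by move=> ij; rewrite br_pv (inj_eq p_inj).
have U4 (i j k l : 'I_n) : uniq [:: i; j; k; l] -> uniq [:: p i; p j; p k; p l].
  by move=> U; rewrite -(map_inj_uniq p_inj) in U.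
have key (i j k l : 'I_n) : uniq [:: i; j; k; l] ->
    let Y := crossratio (p i) (p j) (p k) (p l) in
    [/\ Y != 0, Y != 1 & Y = br (pv (p i)) (pv (p k)) * br (pv (p j)) (pv (p l)) /
       (br (pv (p i)) (pv (p l)) * br (pv (p j)) (pv (p k)))].
  move=> U Y; have XE := crossratio_br (U4 _ _ _ _ U); rewrite -/Y in XE.
  move: U; rewrite /= !inE !negb_or andbT => /and3P[/and3P[ij ik il] /andP[jk jl] kl].
  have D0 : br (pv (p i)) (pv (p l)) * br (pv (p j)) (pv (p k)) != 0 by rewrite mulf_neq0 // G.
  split=> //; first by rewrite XE mulf_neq0 ?invr_eq0 ?mulf_neq0 // G.
  rewrite XE; apply/eqP => /(congr1 (fun z => z * (br (pv (p i)) (pv (p l)) * br (pv (p j)) (pv (p k))))).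
  rewrite mulfVK // mul1r => /eqP; rewrite -subr_eq0.
  (* Three-term Plücker relation: the cross-ratio minus 1 has a product of nonzero brackets as
     numerator. *)
  have -> : br (pv (p i)) (pv (p k)) * br (pv (p j)) (pv (p l)) - br (pv (p i)) (pv (p l)) * br (pv (p j)) (pv (p k))
    = br (pv (p i)) (pv (p j)) * br (pv (p k)) (pv (p l)) by rewrite /br; ring.
  by rewrite mulf_eq0 (negPf (G _ _ ij)) (negPf (G _ _ kl)).
have vE : predn_mod v = v.-1 by rewrite /predn_mod; case: eqP => //; lia.
have ex0 : [exists i in side n u v, i == 0%N :> nat] = (u == 0%N).
  apply/existsP/eqP => [[i /andP[]]|u0].
    by rewrite inE => /orP[]/eqP-> /eqP // v0; lia.
  by exists (Ordinal un); rewrite inE /= u0 !eqxx.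
(* For [u = 0] the preceding edge is [n - 1], which comes last in the increasing enumeration. *)
rewrite /theta ex0; move: aE; rewrite /predn_mod; case: eqP => [u0|u0] aE.
  have vn1 : v != n.-1 by apply: contraNneq nroot => ->; rewrite u0.
  have En : enum (S_of (side n u v)) = [:: b; c; d; a].
    apply: enum_sorted_eq; first by rewrite /= aE bE cE dE; lia.
    move=> x; rewrite mem_S_of_side // vE /predn_mod u0 eqxx !inE -!(inj_eq val_inj) /= aE bE cE dE u0.
    by rewrite [RHS]orbC -!orbA.
  have U : uniq [:: b; c; d; a].
    by rewrite /= !inE -!(inj_eq val_inj) /= aE bE cE dE; lia.
  have [X0 X1 XE] := key _ _ _ _ U.
  have XE' : X = crossratio (p b) (p c) (p d) (p a) by rewrite /X /crS En.
  rewrite -XE' in X0 X1 XE; split=> //.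
  move: U; rewrite /= !inE !negb_or andbT => /and3P[/and3P[bc bd ba] /andP[cd ca] da].
  have h1 := G _ _ ba; have h2 := G _ _ cd.
  have X10 : X - 1 != 0 by rewrite subr_eq0.
  clear XE' En; clearbody X; rewrite /cross; apply: (mulIf X10).
  have -> z : X / (X - 1) * z * (X - 1) = X * z by field.
  by move: h1 h2; rewrite XE /br => h1 h2; field; rewrite h1 h2.
have En : enum (S_of (side n u v)) = [:: a; b; c; d].
  apply: enum_sorted_eq; first by rewrite /= aE bE cE dE; lia.
  move=> x; rewrite mem_S_of_side // vE /predn_mod !inE -!(inj_eq val_inj) /= aE bE cE dE.
  by rewrite (introF eqP u0).
have U : uniq [:: a; b; c; d].
  by rewrite /= !inE -!(inj_eq val_inj) /= aE bE cE dE; lia.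
have [X0 X1 XE] := key _ _ _ _ U.
have XE' : X = crossratio (p a) (p b) (p c) (p d) by rewrite /X /crS En.
rewrite -XE' in X0 X1 XE; split=> //.
move: U; rewrite /= !inE !negb_or andbT => /and3P[/and3P[ab ac ad] /andP[bc bd] cd].
by rewrite /cross XE mulfVK // mulf_neq0 // G.
Qed.

End CrossRatios.

Section CrossRatioEquations.
Variables (n : nat) (K : finType) (lab : K -> {set 'I_n}).
Hypothesis lab_inj : injective lab.

(** The neighbouring edges of the leaves are [u - 1], modulo [n], and [v]; the bound on [v - u]
    keeps them distinct. Each equation then determines its cross-ratio, and [theta] is injective
    away from 1. *)
Lemma sat_crS (t : tree 'I_n K) u v p (y : K -> CC) (i j : 'I_n) :
  injective p -> spans lab t u v -> (v < n)%N -> (v - u < n.-1)%N ->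
  i = predn_mod n u :> nat -> j = v :> nat -> (forall k, y k != 1) ->
  sat (fun k => theta (lab k) (y k)) (pv \o p) t i j <->
  forall k, k \in labels t -> crS p (S_of (lab k)) = y k.
Proof.
move=> p_inj + + + + + y1; elim: t u v i j => [e|k l IHl r IHr] u v i j //=.
move=> [lk [w [sl sr]]] vn uvn iE jE.
have uw := spans_lt sl; have wv := spans_lt sr.
have [l1 l2] := spans_ends sl; have [r1 r2] := spans_ends sr.
have Hl : sat (fun k => theta (lab k) (y k)) (pv \o p) l i (leftmost r) <->
    (forall k, k \in labels l -> crS p (S_of (lab k)) = y k) by apply: IHl sl _ _ _ _ => //; lia.
have Hr : sat (fun k => theta (lab k) (y k)) (pv \o p) r (rightmost l) j <->
    (forall k, k \in labels r -> crS p (S_of (lab k)) = y k).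
  by apply: IHr sr _ _ _ _ => //; rewrite ?l2 /predn_mod; [lia|case: eqP => //; lia].
have nroot : (u, v) != (0%N, n.-1) by apply/eqP => -[]; lia.
have uv2 : (u.+1 < v)%N by lia.
have [X0 X1 C] := cross_crS p_inj uv2 vn nroot iE l1 r2 jE.
have D0 : br (pv (p i)) (pv (p j)) * br (pv (p (leftmost l))) (pv (p (rightmost r))) != 0.
  rewrite mulf_neq0 // br_pv (inj_eq p_inj) -(inj_eq val_inj) /= ?iE ?jE ?l1 ?r2 /predn_mod.
    by move: nroot; rewrite xpair_eqE; case: eqP; lia.
  by apply/eqP; lia.
have Hk : cross (pv (p i)) (pv (p (leftmost l))) (pv (p (rightmost r))) (pv (p j)) (theta (lab k) (y k)) <->
    crS p (S_of (lab k)) = y k.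
  rewrite lk; split=> [C'|<- //]; apply: (@theta_inj _ (side n u v)) => //.
  by apply: (mulIf D0); rewrite -C'; apply/esym/C.
split=> [[/Hk Ck /Hl Sl /Hr Sr] k'|H].
  by rewrite inE mem_cat => /orP[/eqP->//|/orP[/Sl|/Sr]].
split; first by apply/Hk/H/mem_head.
- by apply/Hl => k' kl; apply: H; rewrite inE mem_cat kl orbT.
- by apply/Hr => k' kr; apply: H; rewrite inE mem_cat kr !orbT.
Qed.

Lemma rsat_crS (l r : tree 'I_n K) w p (y : K -> CC) (x : 'I_n) :
  injective p -> spans lab l 0 w -> spans lab r w n.-1 -> (2 < n)%N -> x = n.-1 :> nat ->
  (forall k, k \in labels l ++ labels r) -> (forall k, y k != 1) ->
  rsat (fun k => theta (lab k) (y k)) (pv \o p) l r x <->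
  forall k, crS p (S_of (lab k)) = y k.
Proof.
move=> p_inj sl sr n2 xE full y1.
have w0 := spans_lt sl; have wn := spans_lt sr.
have [l1 l2] := spans_ends sl; have [r1 r2] := spans_ends sr.
have Hl : sat (fun k => theta (lab k) (y k)) (pv \o p) l x (leftmost r) <->
    (forall k, k \in labels l -> crS p (S_of (lab k)) = y k).
  by apply: sat_crS sl _ _ _ _ _ => //; lia.
have Hr : sat (fun k => theta (lab k) (y k)) (pv \o p) r (rightmost l) x <->
    (forall k, k \in labels r -> crS p (S_of (lab k)) = y k).
  by apply: sat_crS sr _ _ _ _ _ => //; rewrite ?l2 /predn_mod; [lia..|case: eqP => //; lia].
split=> [[/Hl Sl /Hr Sr] k|H]; last by split; [apply/Hl|apply/Hr].
by have := full k; rewrite mem_cat => /orP[/Sl|/Sr].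
Qed.

End CrossRatioEquations.

(** * Normal form of a configuration *)

Section NormalForm.
Variable n : nat.
Hypothesis n3 : (3 <= n)%N.

Definition o0 : 'I_n := Ordinal (ltnW (ltnW n3)).
Definition o1 : 'I_n := Ordinal (ltnW n3).
Definition o2 : 'I_n := Ordinal n3.

Fact shift3_subproof (j : 'I_(n - 3)) : (j.+3 < n)%N.
Proof. by have := ltn_ord j; lia. Qed.
Definition shift3 (j : 'I_(n - 3)) : 'I_n := Ordinal (shift3_subproof j).

(* The coordinate of the point [j + 3] after moving the points 0, 1, 2 to
   infinity, 0, 1. *)
Definition nf (P : 'I_n -> CC * CC) : 'rV[CC]_(n - 3) :=
  \row_j ((br (P (shift3 j)) (P o1) * br (P o2) (P o0)) /
          (br (P (shift3 j)) (P o0) * br (P o2) (P o1))).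

Lemma conf_shift3 (x : 'rV[CC]_(n - 3)) j : conf x (shift3 j) = Some (x ord0 j).
Proof. by rewrite /conf /= (valK j). Qed.

Lemma ord_cases (i : 'I_n) : [\/ i = o0, i = o1, i = o2 | exists j, i = shift3 j].
Proof.
case: i => -[|[|[|m]]] Hm.
- by constructor 1; apply: val_inj.
- by constructor 2; apply: val_inj.
- by constructor 3; apply: val_inj.
- have Hj : (m < n - 3)%N by lia.
  by constructor 4; exists (Ordinal Hj); apply: val_inj.
Qed.

Lemma nf_sim P : generic_conf P -> sim (pv \o conf (nf P)) P.
Proof.
move=> G.
have h20 : br (P o2) (P o0) != 0 by apply: G.
have h21 : br (P o2) (P o1) != 0 by apply: G.
have h01 : br (P o0) (P o1) != 0 by apply: G.
apply: sim_trans (sim_frame _ h20 h21 h01); apply: sim_par => i /=.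
case: (ord_cases i) => [->|->|->|[j ->]].
- exact: par_frame_a.
- exact: par_frame_b.
- exact: par_frame_d.
rewrite conf_shift3 mxE /=; have hj : br (P (shift3 j)) (P o0) != 0 by apply: G.
exists (br (P (shift3 j)) (P o0) * br (P o2) (P o1))^-1.
  by rewrite invr_eq0 mulf_neq0.
by rewrite /frame /scale /= mulVf ?mulf_neq0 // mulrC.
Qed.

(** The coordinates of [nf] are cross-ratios, so all scaling factors cancel; on [conf x] they
    evaluate to the coordinates of [x]. *)
Lemma nf_conf x P : generic_conf P -> sim (pv \o conf x) P -> x = nf P.
Proof.
move=> G [z [c [z0 c0 H]]]; apply/rowP => j; rewrite mxE.
have E (e f : 'I_n) : br (P e) (P f) = br (pv (conf x e)) (pv (conf x f)) / (z * c e * c f).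
  by have := H e f; rewrite /= => ->; field; rewrite z0 !c0.
rewrite !E conf_shift3 /br /=; field; rewrite z0 !c0.
by rewrite ?mulr0 ?mulr1 ?sub0r ?subr0 ?oppr_eq0 ?oner_eq0.
Qed.

End NormalForm.

(** * General fibers *)

(** Induction on the number of variables: the last variable is split off, a nonzero coefficient is
    evaluated at a good point, and a non-root is chosen for the last variable. *)
Lemma mpoly_eval_neq0 (F : fieldType) m (g : {mpoly F[m]}) :
  (forall i : nat, i.+1%:R != 0 :> F) -> g != 0 -> exists v : 'I_m -> F, g.@[v] != 0.
Proof.
move=> char0; elim: m g => [|m IH] g g0.
  exists (fun=> 0); apply: contraNneq g0; rewrite mevalE => H.
  apply/eqP/mpolyP => k; rewrite mcoeff0 -H.
  have [kg|kg] := boolP (k \in msupp g); last first.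
    rewrite (memN_msupp_eq0 kg) big1_seq // => k' /andP[_ k'g].
    by move: kg; rewrite (_ : k = k') ?k'g //; apply/mnmP => -[].
  rewrite (big_rem k) //= big_ord0 mulr1 big1_seq ?addr0 // => k' /andP[_].
  rewrite mem_rem_uniq ?msupp_uniq // inE => /andP[/negP[]].
  by apply/eqP/mnmP => -[].
pose wid := @widen_ord m m.+1 (leqnSn m).
pose low (k : 'X_{1..m.+1}) : 'X_{1..m} := [multinom k (wid i) | i < m].
have split_v (k : 'X_{1..m.+1}) (v : 'I_m -> F) z :
    \prod_(i < m.+1) (if unlift ord_max i is Some j then v j else z) ^+ k i
    = (\prod_(i < m) v i ^+ low k i) * z ^+ k ord_max.
  rewrite big_ord_recr /= unlift_none; congr (_ * _); apply: eq_bigr => i _.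
  rewrite mnmE (_ : widen_ord _ i = lift ord_max i); last by apply: val_inj; rewrite /= /bump leqNgt ltn_ord.
  rewrite liftK; congr (_ ^+ k _); apply: val_inj; by rewrite /= /bump leqNgt ltn_ord.
have [k0 k0g] : exists k0, k0 \in msupp g.
  case E : (msupp g) => [|k0 ?]; last by exists k0; rewrite mem_head.
  by move: g0; rewrite -msupp_eq0 E.
(* The coefficient of that power of the last variable which occurs in the chosen monomial [k0]. *)
pose q : {mpoly F[m]} := \sum_(k <- msupp g | k ord_max == k0 ord_max) g@_k *: 'X_[low k].
have q0 : q != 0.
  apply/eqP => /(congr1 (fun q => q@_(low k0))); rewrite mcoeff0 raddf_sum /=.
  rewrite (big_rem k0) //= eqxx mcoeffZ mcoeffX eqxx mulr1 big1_seq ?addr0.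
    by apply/eqP; rewrite -mcoeff_msupp.
  move=> k /andP[/eqP kk]; rewrite mem_rem_uniq ?msupp_uniq // inE => /andP[kk0 _].
  rewrite mcoeffZ mcoeffX; case: eqP => [E|_]; last by rewrite mulr0.
  case/eqP: kk0; apply/mnmP => i; case: (unliftP ord_max i) => [j ->|->] //.
  have -> : lift ord_max j = wid j by apply: val_inj; rewrite /= /bump leqNgt ltn_ord.
  by have := congr1 (fun k' : 'X_{1..m} => k' j) E; rewrite !mnmE.
have [v qv] := IH q q0.
pose h : {poly F} := \sum_(k <- msupp g) (g@_k * \prod_(i < m) v i ^+ low k i) *: 'X^(k ord_max).
have h0 : h != 0.
  apply: contraNneq qv => /(congr1 (fun h : {poly F} => h`_(k0 ord_max))); rewrite coef0 coef_sum => H.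
  rewrite /q raddf_sum /= -[X in _ == X]H [X in X == _]big_mkcond; apply/eqP/eq_bigr => k _.
  rewrite coefZ coefXn eq_sym; case: eqP => _; last by rewrite mulr0.
  by rewrite mulr1 mevalZ mevalX.
have [s Hs] := roots_list h0; have [z zs] := fresh_field char0 s.
exists (fun i => if unlift ord_max i is Some j then v j else z).
apply: contraNneq zs => H; apply: Hs; rewrite /root /h horner_sum; apply/eqP.
rewrite -[RHS]H mevalE; apply: eq_bigr => k _.
by rewrite split_v hornerZ hornerXn mulrA.
Qed.

(** Two nonempty open sets meet inside the target: the product of their equations with [h], which
    vanishes exactly off the target, is a nonzero polynomial. *)
Lemma general_fiber_card_unique n (V : seq {set 'I_n}) d d' :
  is_general_fiber_card V d -> is_general_fiber_card V d' -> d = d'.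
Proof.
move=> [g [g0 Hg]] [g' [g0' Hg']].
pose h : {mpoly CC[size V]} := \prod_(i < size V) ('X_i * ('X_i - 1)).
have hE v : h.@[v] = \prod_i (v i * (v i - 1)).
  by rewrite rmorph_prod; apply: eq_bigr => i _; rewrite /= mevalM mevalB mevalXU meval1.
have h0 : h != 0.
  apply: contraTneq isT => h0; have := hE (fun=> -1); rewrite h0 meval0 => /esym/eqP.
  rewrite prodf_seq_eq0 => /hasP[i _ /=].
  have -> : (-1 * (-1 - 1) : CC) = 2%:R by ring.
  by rewrite (negPf (CC_char0 1)).
have [v] := mpoly_eval_neq0 CC_char0 (mulf_neq0 (mulf_neq0 g0 g0') h0).
rewrite !mevalM !mulf_eq0 !negb_or hE => /andP[/andP[gv gv'] /prodf_neq0 hv].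
pose y : 'rV[CC]_(size V) := \row_j v j.
have yE : (fun j => y ord0 j) =1 v by move=> j; rewrite mxE.
have yT : in_target y.
  by move=> j; rewrite mxE; have := hv j isT; rewrite mulf_eq0 negb_or subr_eq0 => /andP[].
have [|s [Us <- Hs]] := Hg y yT; first by rewrite (meval_eq _ yE).
have [|s' [Us' <- Hs']] := Hg' y yT; first by rewrite (meval_eq _ yE).
apply/perm_size/uniq_perm => // x; apply/idP/idP => [/Hs/Hs'|/Hs'/Hs] //.
Qed.

(** * The general fiber for a triangulation *)

Section Main.
Variables (n : nat) (T : {set {set 'I_n}}).
Hypothesis n4 : (4 <= n)%N.
Hypothesis triT : triangulation T.

Notation V := (U_T T).
Notation K := 'I_(size V).

Definition diag (k : K) : {set 'I_n} := nth set0 (enum T) k.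

Lemma size_U_T : size V = #|T|.
Proof. by rewrite size_map -cardE. Qed.

Lemma ltn_enumT (k : K) : (k < size (enum T))%N.
Proof. by apply: leq_trans (ltn_ord k) _; rewrite size_map. Qed.

Lemma diag_inj : injective diag.
Proof.
by move=> i j /eqP; rewrite nth_uniq ?enum_uniq ?ltn_enumT // => /eqP /val_inj.
Qed.

Lemma diagT D : D \in T <-> exists k, diag k = D.
Proof.
rewrite -mem_enum; split=> [DT|[k <-]]; last by rewrite mem_nth // ltn_enumT.
have iT : (index D (enum T) < size V)%N by rewrite size_map index_mem.
by exists (Ordinal iT); rewrite /diag /= nth_index.
Qed.

Lemma piV_diag x (y : 'rV[CC]_(size V)) :
  piV V x = y <-> forall k, crS (conf x) (S_of (diag k)) = y ord0 k.
Proof.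
have E (k : K) : nth set0 V k = S_of (diag k).
  by rewrite (nth_map set0) // ltn_enumT.
split=> [<- k|H]; first by rewrite mxE E.
by apply/rowP => k; rewrite mxE E.
Qed.

Lemma theta_invol (D : {set 'I_n}) (y : CC) : y != 1 -> theta D (theta D y) = y /\ theta D y != 1.
Proof.
move=> y1; have y10 : y - 1 != 0 by rewrite subr_eq0.
rewrite /theta; case: [exists i in D, _] => //.
have E : y / (y - 1) - 1 = (y - 1)^-1 by field.
split; first by rewrite E; field.
by rewrite -subr_eq0 E invr_eq0.
Qed.

Definition thetas (y : 'rV[CC]_(size V)) (k : K) : CC := theta (diag k) (y ord0 k).

(* Clearing denominators after the change of variables [theta]. *)
Lemma theta_mpoly (g : (K + K -> CC) -> CC) e :
  polyfun (vars [::]) g -> g e != 0 ->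
  exists h : {mpoly CC[size V]}, h != 0 /\
    forall y : 'rV[CC]_(size V), in_target y -> h.@[fun j => y ord0 j] != 0 ->
      g (env_of (thetas y) (thetas y)) != 0.
Proof.
move=> Pg ge.
(* The change of variables has a pole at 1, so the witness is moved to a point none of whose
   cross-ratios is 1. *)
have P1 : polyfun (vars [::]) (fun e : K + K -> CC => \prod_(k : K) (e (inl k) - 1)).
  by apply: pf_prod => k; apply: pf_sub; [apply: pf_var|apply: pf_const].
have [|e'] := pf_mul_neq0 (e1 := fun=> 0) CC_char0 Pg P1 ge.
  by apply/prodf_neq0 => k _; rewrite sub0r oppr_eq0 oner_eq0.
rewrite mulf_eq0 negb_or => /andP[ge' /prodf_neq0 e'1].
(* All values of [theta] are written over this common denominator. *)
pose D : {mpoly CC[size V]} := \prod_i ('X_i - 1).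
pose N (x : K + K) : {mpoly CC[size V]} :=
  match x with
  | inl k => if [exists i in diag k, i == 0%N :> nat]
             then 'X_k * \prod_(i | i != k) ('X_i - 1) else 'X_k * D
  | inr _ => 0
  end.
have DE v : D.@[v] = \prod_i (v i - 1).
  by rewrite rmorph_prod; apply: eq_bigr => i _; rewrite /= mevalB mevalXU meval1.
have NE v k : D.@[v] != 0 -> (N (inl k)).@[v] / D.@[v] = theta (diag k) (v k).
  move=> D0; rewrite /N /theta; case: ifP => _; last by rewrite mevalM mevalXU mulfK.
  have DkE : D.@[v] = (v k - 1) * \prod_(i | i != k) (v i - 1) by rewrite DE (bigD1 k).
  have PE : (\prod_(i | i != k) ('X_i - 1)).@[v] = \prod_(i | i != k) (v i - 1).
    by rewrite rmorph_prod; apply: eq_bigr => i _; rewrite /= mevalB mevalXU meval1.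
  move: D0; rewrite DkE mulf_eq0 negb_or => /andP[h1 h2].
  by rewrite mevalM mevalXU PE; field; rewrite h1 h2.
have [m [h Hh]] := pf_subst (@mpolyC (size V) CC : {rmorphism CC -> {mpoly CC[size V]}}) N D Pg.
have hE v (ty : K -> CC) : D.@[v] != 0 -> (forall k, ty k = theta (diag k) (v k)) ->
    h.@[v] = D.@[v] ^+ m * g (env_of ty ty).
  move=> D0 tyE; rewrite (Hh (meval v : {rmorphism _ -> _}) (fun c => mevalC v c) D0).
  congr (_ * _); apply: (pf_local Pg) => -[k|k] //= _.
  by rewrite NE // tyE.
exists h; split.
  (* Away from 1 [theta] is an involution, so substituting [v] gives back the cross-ratios of [e'],
     where [g] is nonzero. *)
  pose v k := theta (diag k) (e' (inl k)).
  have e1 k : e' (inl k) != 1 by have := e'1 k isT; rewrite subr_eq0.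
  have D0 : D.@[v] != 0.
    rewrite DE; apply/prodf_neq0 => k _; rewrite subr_eq0.
    by have [_] := theta_invol (diag k) (e1 k).
  have := hE v (fun k => e' (inl k)) D0 => H.
  apply: contraNneq ge' => h0; move: H; rewrite h0 meval0 => H.
  have /esym/eqP := H (fun k => esym (proj1 (theta_invol (diag k) (e1 k)))).
  rewrite mulf_eq0 expf_eq0 (negPf D0) andbF /= => /eqP <-.
  by apply/eqP/(pf_local Pg) => -[k|k].
move=> y yT hy.
have D0 : D.@[fun j => y ord0 j] != 0.
  by rewrite DE; apply/prodf_neq0 => k _; rewrite subr_eq0; have [] := yT k.
by apply: contraNneq hy => g0; rewrite (hE _ (thetas y) D0) // g0 mulr0.
Qed.

Lemma general_fiber_card_triangulation :
  is_general_fiber_card V (2 ^ interior_triangles T).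
Proof.
have n3 : (3 <= n)%N by lia.
have [l [r [w [sl sr full]]]] := spans_root diag_inj n4 triT diagT.
have n1 : (n.-1 < n)%N by lia.
have w0 := spans_lt sl; have wn := spans_lt sr; have wn' : (w < n)%N by lia.
(* The edge between the vertices [n - 1] and 0 completes the root triangle; all other edges are
   leaves. *)
pose x := Ordinal n1.
have leavesE : [seq val e | e <- leaves l ++ leaves r] = iota 0 n.-1.
  rewrite map_cat (spans_leaves sl) (spans_leaves sr) subn0.
  have -> : iota 0 n.-1 = iota 0 (w + (n.-1 - w)) by rewrite subnKC // ltnW.
  by rewrite iotaD.
have lv_mem (f : 'I_n) : (f \in leaves l ++ leaves r) = (f < n.-1)%N.
  by rewrite -(mem_map val_inj) leavesE mem_iota.
have Ulv : uniq (x :: leaves l ++ leaves r).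
  by rewrite cons_uniq lv_mem ltnn /= -(map_inj_uniq val_inj) leavesE iota_uniq.
have full_lv f : f \in x :: leaves l ++ leaves r.
  rewrite in_cons lv_mem -(inj_eq val_inj) /=; have := ltn_ord f; lia.
have td : topdown (inner l ++ inner r).
  apply: topdown_inner_cat.
  - exact: spans_uniq_cat sl sr n1 (spans_uniq sl wn') (spans_uniq sr n1).
  - exact/topdown_inner/(spans_uniq sl wn').
  - exact/topdown_inner/(spans_uniq sr n1).
have sat_iff p (y : K -> CC) : injective p -> (forall k, y k != 1) ->
    rsat (fun k => theta (diag k) (y k)) (pv \o p) l r x <-> forall k, crS p (S_of (diag k)) = y k.
  by move=> p_inj y1; apply: rsat_crS sl sr _ _ full y1.
have conf_generic (p : 'I_n -> P1) : injective p -> generic_conf (pv \o p).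
  by move=> p_inj e f ef /=; rewrite br_pv (inj_eq p_inj).
(* Any configuration of distinct points serves as reference; the integers are distinct in
   characteristic 0. *)
pose p0 (i : 'I_n) : P1 := Some (i%:R).
have p0_inj : injective p0.
  by move=> i j [] /(natr_inj0 CC_char0) /val_inj.
pose X0 k := crS p0 (S_of (diag k)).
have X0_neq k : X0 k != 0 /\ X0 k != 1.
  have /(triangulation_side n4 triT) [a [b [ab bn nroot kE]]] : diag k \in T by apply/diagT; exists k.
  have [h1 [h2 [h3 h4]]] : (predn_mod n a < n /\ a < n /\ b.-1 < n /\ b < n)%N.
    by rewrite /predn_mod; case: eqP => _; lia.
  have [] := @cross_crS n p0 a b (Ordinal h1) (Ordinal h2) (Ordinal h3) (Ordinal h4) p0_inj ab bn nroot erefl erefl erefl erefl.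
  by rewrite /X0 kE.
have [||g [e1 [Pg ge1 Hg]]] := @generic_count CC _ _ CC_char0 CC_sqrt l r x (pv \o p0)
    (fun k => theta (diag k) (X0 k)) Ulv full_lv td (conf_generic _ p0_inj).
- by move=> k; have [a b] := X0_neq k; apply: theta_neq.
- by apply/sat_iff => // k; have [] := X0_neq k.
have [h [h0 Hh]] := theta_mpoly Pg ge1.
exists h; split=> // y yT hy.
have [|P [P1 P2 P3]] := Hg (thetas y) _ (Hh y yT hy).
  by move=> k; have [a b] := yT k; apply: theta_neq.
have y1 k : y ord0 k != 1 by have [] := yT k.
set I0 := [set k in _] in P1 P2 P3.
(* Each similarity class contributes its unique normal form, so the fiber is indexed by the subsets
   of [I0]. *)
exists [seq nf n3 (P A) | A <- enum (powerset I0)]; split.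
- rewrite map_inj_in_uniq ?enum_uniq // => A B; rewrite !mem_enum !powersetE => AI BI E.
  apply: P2 => //; have [GA _] := P1 A AI; have [GB _] := P1 B BI.
  apply: sim_trans (sim_sym (nf_sim n3 GA)) _; rewrite E; exact: nf_sim.
- rewrite size_map -cardE card_powerset cardsE (card_uniqP (topdown_uniq td)) size_map.
  by rewrite (interior_triangles_inner diag_inj n4 diagT sl sr full).
- move=> z; split=> [/mapP [A]|[zM /piV_diag zy]].
    rewrite mem_enum powersetE => AI ->; have [GA SA] := P1 A AI.
    have S := nf_sim n3 GA.
    have zM : in_M0n (nf n3 (P A)).
      move=> i j E; apply/eqP; apply: contraT => ij.
      have [c [d [c0 d0 H]]] := S; have := H i j; rewrite /= E brxx => /esym/eqP.
      by rewrite !mulf_eq0 (negPf c0) !(negPf (d0 _)) (negPf (GA _ _ ij)).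
    split=> //; apply/piV_diag; apply/(sat_iff _ _ zM) => //.
    by have [s1 s2] := SA; split; apply: sim_sat S _.
  have /(sat_iff _ _ zM y1) Sz := zy.
  have [A AI SA] := P3 _ (conf_generic _ zM) Sz.
  have [GA _] := P1 A AI.
  apply/mapP; exists A; first by rewrite mem_enum powersetE.
  by apply: nf_conf => //; apply: sim_sym.
Qed.

End Main.

Theorem theorem1p1 (n : nat) (T : {set {set 'I_n}}) :
  (4 <= n)%N -> triangulation T -> d_T T = (2 ^ interior_triangles T)%N.
Proof.
move=> n4 triT; have H := general_fiber_card_triangulation n4 triT.
rewrite /d_T /crdeg size_U_T; have [_ -> _] := triT; rewrite eqxx.
(* The value picked by [epsilon] is a general fiber cardinality because one exists, and uniqueness
   identifies it. *)
apply: (general_fiber_card_unique _ H).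
exact: (epsilon_spec (inhabits 0%N) (is_general_fiber_card (U_T T)) (ex_intro _ _ H)).
Qed.
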